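(* Let $\mu$ be a probability measure on $\mathbb{R}$ satisfying the standing assumptions below and $\int_{\mathbb{R}}|x|\,d\mu<+\infty$, with support interval $I$; assume moreover that either $\mu$ has compact support or there exists $\delta>0$ with $\int_{\mathbb{R}}|x|^{2+\delta}d\mu<+\infty$. Let $\vec X_n$ be a vector of $n$ i.i.d. variables with law $\mu$ and $\vec v\in(0,1)^k$ a percentile vector. Then \[ \Bigg|\frac{\mathbb{E}[SC_{\vec v}(\vec X_n)]}{\mathbb{E}[SC_{opt}(\vec X_n)]}-\frac{W_1(\mu,\nu_{Q_{\vec v}})}{W_1(\mu,\nu^{(k)})}\Bigg|\le O(n^{-1/2}), \] and there exists $C>0$ such that \[ B^{(n)}_{ar}(\mathcal{PM}_{\vec v})\le \frac{W_1(\mu,\nu_{Q_{\vec v}})}{W_1(\mu,\nu^{(k)})}+\frac{C}{\sqrt n}\qquad\text{for all } n>k, \] where $\nu^{(k)}$ is a minimizer of $\min_{\lambda\in\mathcal{P}_k(\mathbb{R})}W_1(\mu,\lambda)$ and $\nu_{Q_{\vec v}}=\sum_{i=1}^k(F_\mu(z_i)-F_\mu(z_{i-1}))\delta_{F_\mu^{[-1]}(v_i)}$ with $z_i=\frac{F_\mu^{[-1]}(v_i)+F_\mu^{[-1]}(v_{i+1})}{2}$ ($1\le i\le k-1$), $z_0=\inf I$, $z_k=\sup I$.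
   Context: For $\vec x\in\mathbb{R}^n$, $\vec y\in\mathbb{R}^k$: $SC(\vec x,\vec y)=\frac1n\sum_i\min_j|x_i-y_j|$, $SC_{opt}(\vec x)=\min_{\vec y}SC(\vec x,\vec y)$. A percentile vector is $\vec v$ with $0\le v_1\le\dots\le v_k\le1$; the percentile mechanism $\mathcal{PM}_{\vec v}$ sorts the reports $x_{(1)}\le\dots\le x_{(n)}$ and places facility $j$ at $x_{(\lfloor(n-1)v_j\rfloor+1)}$; $SC_{\vec v}(\vec x)$ is the Social Cost of its output. The Bayesian approximation ratio is $B^{(n)}_{ar}(f)=\mathbb{E}[SC_f(\vec X_n)]/\mathbb{E}[SC_{opt}(\vec X_n)]$. $\mathcal{P}_k(\mathbb{R})$: probability measures $\sum_{j=1}^k\nu_j\delta_{x_j}$. $W_1$: 1-Wasserstein distance. $F_\mu$: c.d.f. of $\mu$, $F_\mu^{[-1]}(t)=\inf\{x:F_\mu(x)\ge t\}$. Standing assumptions on $\mu$: absolutely continuous with density $\rho_\mu$; support an interval on whose interior $\rho_\mu>0$; $\rho_\mu$ differentiable on the support. *)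

(* Defs.v *)
From HB Require Import structures.
From mathcomp Require Import all_boot all_order all_algebra.
From mathcomp Require Import all_classical all_reals all_analysis.
Set Implicit Arguments. Unset Strict Implicit. Unset Printing Implicit Defensive.
Import Order.TTheory GRing.Theory Num.Theory.
Import numFieldNormedType.Exports.
Local Open Scope classical_set_scope.
Local Open Scope ring_scope.

Section FacilityDefs.
Context {R : realType}.

Definition SC (xs ys : seq R) : \bar R :=
  (((size xs)%:R)^-1)%:E *
  (\sum_(x <- xs) \big[Order.min/+oo%E]_(y <- ys) (`|x - y|)%:E)%E.

Definition SC_opt (k : nat) (xs : seq R) : \bar R :=
  ereal_inf [set SC xs ys | ys in [set ys : seq R | size ys = k]].

(* Percentile mechanism PM_v: sort reports, facility j at x_(floor((n-1)v_j)+1)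
   (1-indexed), i.e. index floor((n-1)v_j) (0-indexed) of the sorted list. *)
Definition PM (v : seq R) (xs : seq R) : seq R :=
  [seq nth 0 (sort <=%R xs) (Num.truncn ((size xs).-1%:R * vj)) | vj <- v].

(* Expectation of f(X_1,...,X_n) for X_1..X_n i.i.d. with law mu,
   as the iterated integral w.r.t. mu (n-fold product measure). *)
Fixpoint iid_expect (mu : {measure set R -> \bar R}) (n : nat)
  (f : seq R -> \bar R) : \bar R :=
  match n with
  | 0 => f [::]
  | m.+1 => (\int[mu]_x iid_expect mu m (fun s => f (x :: s)))%E
  end.

Definition B_ar_PM (mu : {measure set R -> \bar R}) (k n : nat) (v : seq R) : R :=
  fine (iid_expect mu n (fun xs => SC xs (PM v xs))) /
  fine (iid_expect mu n (SC_opt k)).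

Definition coupling (mu nu : set R -> \bar R) (pi : probability (R * R)%type R) :=
  forall A : set R, measurable A ->
    pi (A `*` setT) = mu A /\ pi (setT `*` A) = nu A.

Definition W1 (mu nu : set R -> \bar R) : \bar R :=
  ereal_inf [set (\int[pi]_z (`|z.1 - z.2|)%:E)%E | pi in coupling mu nu].

Definition Pk (k : nat) : set (set R -> \bar R) :=
  [set lam | exists (w x : 'I_k -> R),
     (forall j, 0 <= w j) /\ \sum_(j < k) w j = 1 /\
     lam = (fun A => \sum_(j < k) (w j)%:E * \d_(x j) A)%E].

(* W1(mu, nu^(k)) = min_{lambda in P_k} W1(mu, lambda). *)
Definition W1_k (mu : set R -> \bar R) (k : nat) : \bar R :=
  ereal_inf [set W1 mu lam | lam in Pk k].

Definition cdf (mu : set R -> \bar R) (x : R) : R := fine (mu [set` `]-oo, x]]).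
Definition cdf_inv (mu : set R -> \bar R) (t : R) : R :=
  inf [set x : R | t <= cdf mu x].

(* nu_{Q_v}: atoms q_j = F^{[-1]}(v_j), weights F(z_i) - F(z_{i-1}) with
   z_i midpoints of consecutive atoms, F(z_0) = 0, F(z_k) = 1. Indices below:
   atoms 0-indexed j < k, Fz i for i = 0..k (1-indexed z's). *)
Definition nuQ_atom (mu : set R -> \bar R) (v : seq R) (j : nat) : R :=
  cdf_inv mu (nth 0 v j).
Definition nuQ_Fz (mu : set R -> \bar R) (v : seq R) (i : nat) : R :=
  if i == 0%N then 0
  else if i == size v then 1
  else cdf mu ((nuQ_atom mu v i.-1 + nuQ_atom mu v i) / 2).
Definition nuQ (mu : set R -> \bar R) (v : seq R) : set R -> \bar R :=
  fun A => (\sum_(j < size v)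
     (nuQ_Fz mu v j.+1 - nuQ_Fz mu v j)%:E * \d_(nuQ_atom mu v j) A)%E.

Definition msupport (mu : set R -> \bar R) : set R :=
  [set x | forall e : R, 0 < e -> (0 < mu (ball x e))%E].

(* Standing assumptions: absolutely continuous with density rho, support an
   interval I, rho > 0 on the interior of I, rho differentiable on I
   (one-sided at endpoints belonging to I). *)
Definition standing_assumptions (mu : {measure set R -> \bar R})
  (I : interval R) :=
  exists rho : R -> R,
    [/\ measurable_fun setT rho /\ (forall x, 0 <= rho x),
        (forall A, measurable A ->
           mu A = (\int[lebesgue_measure]_(x in A) (rho x)%:E)%E),
        msupport mu = [set x | x \in I],
        (forall x, interior [set y | y \in I] x -> 0 < rho x) &
        (forall x, x \in I ->
           cvg ((fun h => (rho (x + h) - rho x) / h) @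
                  within [set h | x + h \in I] (0 : R)^'))].

End FacilityDefs.

(* Main.v *)
Require Import Defs.
From HB Require Import structures.
From mathcomp Require Import all_boot all_order all_algebra.
From mathcomp Require Import all_classical all_reals all_analysis.
From mathcomp Require Import measurable_realfun ring lra.
Import Order.TTheory GRing.Theory Num.Theory.
Import numFieldNormedType.Exports Defs.
Set Implicit Arguments. Unset Strict Implicit. Unset Printing Implicit Defensive.
Local Open Scope classical_set_scope.
Local Open Scope ring_scope.

(* Write c(y) for the integral of x |-> min_j |x - y_j| against mu. Then
   W1(mu, nu_Q) = c(q), with q_j the v_j-quantiles, and the minimum of W1(mu, .)
   over P_k is the infimum of c(y) over k-point configurations y; it is positive
   because mu has a density bounded below near a quantile. It thus suffices to
   compare both expectations with these two numbers up to O(n^(-1/2)).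

   The cost of PM_v differs from that of the fixed locations q by at most
   sum_j |X_(r_j) - q_j|. Since F grows linearly at q_j, Chebyshev's inequality
   at the scales 2^m n^(-1/2), together with the second moment for large
   deviations, gives E |X_(r_j) - q_j| = O(n^(-1/2)).

   The optimal cost has mean at most inf c(y). For the converse,
   c(y) - SC(X, y) is bounded, uniformly in y, by a discretised form of
   the integral of |F_n - F|, with mean
   O(n^(-1/2)) * int (F (1 - F))^(1/2), which the moment of order 2 + delta
   makes finite.

   Only iterated integrals occur, and all random variables involved are either
   Lipschitz in the sample or explicit polynomials of degree at most 2 in sums
   over the sample. *)

(** * Iterated expectations over an i.i.d. sample *)

Section IteratedExpectation.
Context {R : realType} (mu : probability R R).

(** In the lower bound for the optimum the best y depends on the sample, so an estimate at a fixed y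
    does not suffice. The way out is that x |-> min_j |x - y_j| is 1-Lipschitz whatever y is: the
    supremum of the deviation over all 1-Lipschitz functions is W1 between mu and the empirical
    measure, which on the line is the integral of |F_n - F|. A second difficulty is that only
    squares of centred sums have means computable by induction, while absolute values must be
    bounded. At a grid node, |V| is therefore replaced by (V^2 / a + a) / 2, where a bounds the
    standard deviation of V. The length h = n^(-1/2) serves throughout: as smallest scale of
    deviation, as mesh of the grid and, through its inverse, as truncation point, since |x| - 1/h <=
    h x^2 turns the tails into a second moment. *)

Definition has_mean (g : R -> R) (e : R) :=
  mu.-integrable setT (EFin \o g) /\ \int[mu]_x g x = e.

Lemma has_mean_Rintegral (g : R -> R) :
  mu.-integrable setT (EFin \o g) -> has_mean g (\int[mu]_x g x).
Proof. by []. Qed.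

Lemma has_mean_integral (g : R -> R) (e : R) :
  has_mean g e -> (\int[mu]_x (g x)%:E = e%:E)%E.
Proof.
by move=> [ig <-]; rewrite /Rintegral fineK//; exact: integrable_fin_num.
Qed.

Lemma has_mean_cst (a : R) : has_mean (fun=> a) a.
Proof.
split; last by rewrite Rintegral_cst//= (@probability_setT _ _ _ mu) mulr1.
exact: finite_measure_integrable_cst.
Qed.

Lemma has_meanD (f g : R -> R) (a b : R) :
  has_mean f a -> has_mean g b -> has_mean (fun x => f x + g x) (a + b).
Proof.
move=> [fi <-] [gi <-]; split; last by rewrite RintegralD.
exact: (integrableD measurableT fi gi).
Qed.

Lemma has_meanZ (r : R) (f : R -> R) (a : R) :
  has_mean f a -> has_mean (fun x => r * f x) (r * a).
Proof.
move=> [fi <-]; split; last by rewrite RintegralZl.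
exact: (integrableZl measurableT r fi).
Qed.

Lemma has_mean_le (f g : R -> R) (a b : R) :
  has_mean f a -> has_mean g b -> (forall x, f x <= g x) -> a <= b.
Proof. by move=> [fi <-] [gi <-] fg; apply: le_Rintegral. Qed.

(* Existence of every intermediate integral is built in, so that linearity and
   monotonicity need no joint measurability in the n variables. *)
Fixpoint has_iid_mean (n : nat) (f : seq R -> R) (e : R) : Prop :=
  match n with
  | 0 => f [::] = e
  | m.+1 => exists2 g : R -> R,
      forall x, has_iid_mean m (fun s => f (x :: s)) (g x) & has_mean g e
  end.

Lemma eq_iid_expect (n : nat) (f g : seq R -> \bar R) :
  (forall s, size s = n -> f s = g s) -> iid_expect mu n f = iid_expect mu n g.
Proof.
elim: n f g => [|n IH] f g fg /=; first exact: fg.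
by apply: eq_integral => x _; apply: IH => s sn; apply: fg; rewrite /= sn.
Qed.

Lemma has_iid_mean_expect (n : nat) (f : seq R -> R) (e : R) :
  has_iid_mean n f e -> iid_expect mu n (EFin \o f) = e%:E.
Proof.
elim: n f e => [|n IH] f e /=; first by move=> ->.
move=> [g gE ge]; rewrite -(has_mean_integral ge).
by apply: eq_integral => x _; exact: (IH _ _ (gE x)).
Qed.

Lemma eq_has_iid_mean (n : nat) (f g : seq R -> R) (e : R) :
  (forall s, size s = n -> f s = g s) -> has_iid_mean n f e ->
  has_iid_mean n g e.
Proof.
elim: n f g e => [|n IH] f g e fg /=; first by rewrite -fg.
move=> [h hE he]; exists h => // x; apply: IH (hE x) => s sn.
by apply: fg; rewrite /= sn.
Qed.

Lemma has_iid_mean_cst (n : nat) (a : R) : has_iid_mean n (fun=> a) a.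
Proof. by elim: n => [|n IH] //=; exists (fun=> a) => //; exact: has_mean_cst. Qed.

Lemma has_iid_meanD (n : nat) (f g : seq R -> R) (a b : R) :
  has_iid_mean n f a -> has_iid_mean n g b ->
  has_iid_mean n (fun s => f s + g s) (a + b).
Proof.
elim: n f g a b => [|n IH] f g a b /=; first by move=> -> ->.
move=> [f' fE fa] [g' gE gb]; exists (fun x => f' x + g' x).
  by move=> x; exact: IH.
exact: has_meanD.
Qed.

Lemma has_iid_meanZ (n : nat) (r : R) (f : seq R -> R) (a : R) :
  has_iid_mean n f a -> has_iid_mean n (fun s => r * f s) (r * a).
Proof.
elim: n f a => [|n IH] f a /=; first by move=> ->.
move=> [f' fE fa]; exists (fun x => r * f' x).
  by move=> x; exact: IH.
exact: has_meanZ.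
Qed.

Lemma has_iid_mean_sum (J : Type) (r : seq J) (n : nat)
    (f : J -> seq R -> R) (a : J -> R) :
  (forall j, has_iid_mean n (f j) (a j)) ->
  has_iid_mean n (fun s => \sum_(j <- r) f j s) (\sum_(j <- r) a j).
Proof.
move=> fa; elim: r => [|j r IH].
  rewrite big_nil; apply: eq_has_iid_mean (has_iid_mean_cst n 0).
  by move=> s _; rewrite big_nil.
rewrite big_cons; apply: eq_has_iid_mean (has_iid_meanD (fa j) IH).
by move=> s _; rewrite big_cons.
Qed.

Lemma has_iid_mean_le (n : nat) (f g : seq R -> R) (a b : R) :
  has_iid_mean n f a -> has_iid_mean n g b ->
  (forall s, size s = n -> f s <= g s) -> a <= b.
Proof.
elim: n f g a b => [|n IH] f g a b /=; first by move=> <- <-; exact.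
move=> [f' fE fa] [g' gE gb] fg; apply: (has_mean_le fa gb) => x.
by apply: IH (fE x) (gE x) _ => s sn; apply: fg; rewrite /= sn.
Qed.

(** The offset [a] collects the contribution of the coordinates already fixed; the induction needs
    it to be arbitrary. *)
Lemma has_iid_mean_linear (n : nat) (a : R) (phi : R -> R) (m : R) :
  has_mean phi m ->
  has_iid_mean n (fun s => a + \sum_(x <- s) phi x) (a + n%:R * m).
Proof.
move=> pm; elim: n a => [|n IH] a /=; first by rewrite big_nil mul0r.
exists (fun x => (a + n%:R * m) + phi x).
  move=> x; apply: eq_has_iid_mean (_ : has_iid_mean _ _ _).
    by move=> s _; rewrite big_cons addrA.
  by rewrite [X in has_iid_mean _ _ X]addrAC; exact: IH.
rewrite -natr1 mulrDl mul1r addrA.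
exact: has_meanD (has_mean_cst _) pm.
Qed.

(** Additivity of the variance: when a coordinate is integrated out, the cross term [2 * a * psi x]
    vanishes because [psi] is centred. *)
Lemma has_iid_mean_square (n : nat) (a : R) (psi : R -> R) (m : R) :
  has_mean psi 0 -> has_mean (fun x => psi x ^+ 2) m ->
  has_iid_mean n (fun s => (a + \sum_(x <- s) psi x) ^+ 2) (a ^+ 2 + n%:R * m).
Proof.
move=> p0 p2; elim: n a => [|n IH] a /=; first by rewrite big_nil mul0r !addr0.
exists (fun x => (a ^+ 2 + n%:R * m) + ((2 * a) * psi x + psi x ^+ 2)).
  move=> x; apply: eq_has_iid_mean (_ : has_iid_mean _ _ _).
    by move=> s _; rewrite big_cons addrA.
  have -> : a ^+ 2 + n%:R * m + (2 * a * psi x + psi x ^+ 2) =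
     (a + psi x) ^+ 2 + n%:R * m by ring.
  exact: IH.
have -> : a ^+ 2 + n.+1%:R * m = (a ^+ 2 + n%:R * m) + ((2 * a) * 0 + m).
  by rewrite -natr1; ring.
by apply: has_meanD (has_mean_cst _) _; apply: has_meanD => //; exact: has_meanZ.
Qed.

Definition lipschitz1 (L : R) (g : R -> R) :=
  forall x y, `|g x - g y| <= L * `|x - y|.

Hypothesis mom1 : mu.-integrable setT (EFin \o (fun x : R => `|x|)).

Lemma lipschitz1_integrable (L : R) (g : R -> R) :
  0 <= L -> lipschitz1 L g -> mu.-integrable setT (EFin \o g).
Proof.
move=> L0 gL; apply: (@le_integrable _ _ _ mu setT _ _
  (EFin \o (fun x => `|g 0| + L * `|x|))) => //.
- apply/measurable_EFinP; apply: continuous_measurable_fun => x.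
  apply/(@cvgrPdist_le _ R^o) => e e0; near=> y.
  apply: (le_trans (gL x y)); apply: (@le_trans _ _ ((L + 1) * `|x - y|)).
    by rewrite ler_wpM2r// lerDl.
  rewrite -ler_pdivlMl; last by rewrite ltr_wpDl.
  near: y; apply: (@cvgr_dist_le _ R^o) => //.
  by rewrite mulr_gt0// invr_gt0 ltr_wpDl.
- move=> x _ /=; rewrite lee_fin.
  rewrite [leRHS]ger0_norm; last by rewrite addr_ge0// mulr_ge0.
  have := gL x 0; rewrite subr0 => gx.
  have : `|g x| <= `|g x - g 0| + `|g 0|.
    by rewrite -{1}(subrK (g 0) (g x)) ler_normD.
  lra.
- by case: (has_meanD (has_mean_cst `|g 0|)
    (has_meanZ L (has_mean_Rintegral mom1))).
Unshelve. all: by end_near. Qed.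

Definition l1dist (s t : seq R) := \sum_(p <- zip s t) `|p.1 - p.2|.

Definition lipschitz_seq (n : nat) (L : R) (f : seq R -> R) :=
  forall s t, size s = n -> size t = n -> `|f s - f t| <= L * l1dist s t.

Lemma l1dist_refl (s : seq R) : l1dist s s = 0.
Proof.
rewrite /l1dist; elim: s => [|x s IH] /=; first by rewrite big_nil.
by rewrite big_cons IH/= subrr normr0 addr0.
Qed.

(** Integrating out the tail of the sample preserves the Lipschitz constant, by monotonicity of the
    mean. The remaining function of one variable is thus continuous with linear growth, and the
    first moment makes it integrable. *)
Lemma lipschitz_has_iid_mean (n : nat) (L : R) (f : seq R -> R) :
  0 <= L -> lipschitz_seq n L f -> exists e, has_iid_mean n f e.
Proof.
move=> L0; elim: n f => [|n IH] f fL; first by exists (f [::]).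
have /(_ _)/cid H x : exists e, has_iid_mean n (fun s => f (x :: s)) e.
  apply: IH => s t sn tn; have := fL (x :: s) (x :: t).
  rewrite /= sn tn => /(_ erefl erefl)/le_trans; apply.
  by rewrite /l1dist/= big_cons/= subrr normr0 add0r.
pose g x := projT1 (H x).
have gE x : has_iid_mean n (fun s => f (x :: s)) (g x) by exact: (projT2 (H x)).
exists (\int[mu]_x g x), g => //.
apply: has_mean_Rintegral; apply: (lipschitz1_integrable L0) => x y.
have gB : forall u w, g u <= g w + L * `|u - w|.
  move=> u w; apply: (has_iid_mean_le (gE u)
    (has_iid_meanD (gE w) (has_iid_mean_cst n (L * `|u - w|)))) => s sn.
  have := fL (u :: s) (w :: s); rewrite /= sn => /(_ erefl erefl).
  rewrite /l1dist/= big_cons/= -/(l1dist s s) l1dist_refl addr0 => /ler_normlP[].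
  lra.
by apply/ler_normlP; split; have := gB x y; have := gB y x; rewrite (distrC y x); lra.
Qed.

End IteratedExpectation.

(** * Social cost and order statistics as Lipschitz functions of the sample *)

Section SocialCost.
Context {R : realType}.
Implicit Types (s t xs ys : seq R) (x y q : R).

(** For empty [ys] the minimum is [+oo] and [fine] returns 0; hence the nonemptiness hypotheses that
    follow. *)
Definition mindist ys x : R :=
  fine (\big[Order.min/+oo%E]_(y <- ys) (`|x - y|)%:E).

Lemma bigmin_dist_attained ys x : (0 < size ys)%N ->
  exists2 y, y \in ys &
    (\big[Order.min/+oo%E]_(y <- ys) (`|x - y|)%:E = (`|x - y|)%:E)%E.
Proof.
elim: ys => [//|y [|z ys] IH] _.
  by exists y; rewrite ?mem_seq1// big_seq1.
have [//|w wys E] := IH; rewrite big_cons E -EFin_min.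
case: (leP `|x - y| `|x - w|) => h; first by exists y; rewrite ?mem_head.
by exists w; rewrite // inE wys orbT.
Qed.

Lemma mindistE ys x : (0 < size ys)%N ->
  (\big[Order.min/+oo%E]_(y <- ys) (`|x - y|)%:E = (mindist ys x)%:E)%E.
Proof.
by move=> /(bigmin_dist_attained x)[y _ E]; rewrite /mindist E.
Qed.

Lemma mindist_attained ys x : (0 < size ys)%N ->
  exists2 y, y \in ys & mindist ys x = `|x - y|.
Proof.
by move=> /(bigmin_dist_attained x)[y yys E]; exists y => //; rewrite /mindist E.
Qed.

Lemma mindist_le ys x y : y \in ys -> mindist ys x <= `|x - y|.
Proof.
move=> yys; have ys0 : (0 < size ys)%N by case: ys yys.
rewrite -lee_fin -mindistE//.
elim: ys yys {ys0} => [//|z ys IH]; rewrite inE big_cons ge_min => /orP[/eqP->|/IH->].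
  by rewrite lexx.
by rewrite orbT.
Qed.

Lemma mindist_ge0 ys x : 0 <= mindist ys x.
Proof.
case: ys => [|z ys]; first by rewrite /mindist big_nil.
by have [y _ ->] := @mindist_attained (z :: ys) x isT.
Qed.

Lemma mindist_lipschitz ys : (0 < size ys)%N -> lipschitz1 1 (mindist ys).
Proof.
move=> ys0; have B u w : mindist ys u <= mindist ys w + `|u - w|.
  have [y yys ->] := mindist_attained w ys0.
  apply: (le_trans (mindist_le u yys)).
  by rewrite [leRHS]addrC; exact: ler_distD.
move=> x y; rewrite mul1r; apply/ler_normlP; split.
  by have := B y x; rewrite (distrC y x); lra.
by have := B x y; lra.
Qed.

(** Allows a configuration of facilities to be replaced by its sorted version. *)
Lemma mindist_perm ys zs x : ys =i zs -> (0 < size ys)%N -> (0 < size zs)%N ->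
  mindist ys x = mindist zs x.
Proof.
move=> yz ys0 zs0; apply/le_anti/andP; split.
  have [z zzs ->] := mindist_attained x zs0; apply: mindist_le.
  by rewrite yz.
have [z zzs ->] := mindist_attained x ys0; apply: mindist_le.
by rewrite -yz.
Qed.

Lemma mindist_close ys zs x d : (0 < size ys)%N -> size ys = size zs ->
  (forall j, (j < size ys)%N -> `|nth 0 ys j - nth 0 zs j| <= d) ->
  `|mindist ys x - mindist zs x| <= d.
Proof.
move=> ys0 yz dd; apply/ler_normlP; rewrite opprB !lerBlDr; split.
  have [y /(nthP 0)[j jn <-] ->] := mindist_attained x ys0.
  apply: (le_trans (@mindist_le zs x (nth 0 zs j) _)); first by rewrite mem_nth -?yz.
  have := ler_distD (nth 0 ys j) x (nth 0 zs j); have := dd j jn; lra.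
have zs0 : (0 < size zs)%N by rewrite -yz.
have [y /(nthP 0)[j jn <-] ->] := mindist_attained x zs0.
apply: (le_trans (@mindist_le ys x (nth 0 ys j) _)); first by rewrite mem_nth ?yz.
rewrite -yz in jn.
have := ler_distD (nth 0 zs j) x (nth 0 ys j); have := dd j jn; rewrite (distrC (nth 0 ys j)); lra.
Qed.

Definition scost xs ys : R := (size xs)%:R^-1 * \sum_(x <- xs) mindist ys x.

Lemma SCE xs ys : (0 < size ys)%N -> SC xs ys = (scost xs ys)%:E.
Proof.
move=> ys0; rewrite /SC /scost EFinM -sumEFin; congr (_ * _)%E.
by apply: eq_bigr => x _; rewrite mindistE.
Qed.

Lemma scost_ge0 xs ys : 0 <= scost xs ys.
Proof.
by rewrite mulr_ge0 ?invr_ge0// sumr_ge0// => x _; rewrite mindist_ge0.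
Qed.

Definition scost_opt (k : nat) xs : R := fine (SC_opt k xs).

Lemma SC_optE (k : nat) xs : (0 < k)%N -> SC_opt k xs = (scost_opt k xs)%:E.
Proof.
move=> k0; rewrite /scost_opt fineK// fin_numElt; apply/andP; split.
  apply: (@lt_le_trans _ _ 0%E) => //; apply: le_ereal_inf_tmp => _ [ys /= ysk <-].
  by rewrite SCE ?ysk// lee_fin scost_ge0.
apply: (@le_lt_trans _ _ (SC xs (nseq k 0))).
  by apply: ereal_inf_lbound; exists (nseq k 0) => //=; rewrite size_nseq.
by rewrite SCE ?size_nseq// ltry.
Qed.

Lemma scost_opt_le (k : nat) xs ys : (0 < k)%N -> size ys = k ->
  scost_opt k xs <= scost xs ys.
Proof.
move=> k0 ysk; rewrite -lee_fin -SC_optE// -SCE ?ysk//.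
by apply: ereal_inf_lbound; exists ys.
Qed.

Lemma le_scost_opt (k : nat) xs a : (0 < k)%N ->
  (forall ys, size ys = k -> a <= scost xs ys) -> a <= scost_opt k xs.
Proof.
move=> k0 H; rewrite -lee_fin -SC_optE//.
apply: le_ereal_inf_tmp => _ [ys /= ysk <-]; rewrite SCE ?ysk// lee_fin.
exact: H.
Qed.

Lemma l1dist_ge0 s t : 0 <= l1dist s t.
Proof. by rewrite sumr_ge0. Qed.

Lemma l1dist_cons x s y t : l1dist (x :: s) (y :: t) = `|x - y| + l1dist s t.
Proof. by rewrite /l1dist/= big_cons. Qed.

Lemma l1distC s t : l1dist s t = l1dist t s.
Proof.
elim: s t => [|x s IH] [|y t]; rewrite /l1dist/= ?big_nil ?big_cons//.
by move: (IH t); rewrite /l1dist => ->; rewrite distrC.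
Qed.

Lemma sum_lipschitz s t (f : R -> R) : size s = size t -> lipschitz1 1 f ->
  `|\sum_(x <- s) f x - \sum_(x <- t) f x| <= l1dist s t.
Proof.
move=> + fL; elim: s t => [|x s IH] [|y t] //=.
  by rewrite !big_nil subrr normr0 l1dist_ge0.
move=> [st]; rewrite !big_cons l1dist_cons opprD addrACA.
apply: (le_trans (ler_normD _ _)); rewrite lerD ?IH//.
by have := fL x y; rewrite mul1r.
Qed.

Lemma scost_lipschitz s t ys : (0 < size ys)%N -> (0 < size s)%N ->
  size s = size t -> `|scost s ys - scost t ys| <= l1dist s t.
Proof.
move=> ys0 s0 st; rewrite /scost -st -mulrBr normrM ger0_norm ?invr_ge0//.
rewrite ler_pdivrMl ?ltr0n//.
apply: (le_trans (sum_lipschitz st (mindist_lipschitz ys0))).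
by rewrite ler_peMl ?l1dist_ge0// ler1n.
Qed.

Lemma scost_close s ys zs d : (0 < size s)%N -> (0 < size ys)%N ->
  size ys = size zs ->
  (forall j, (j < size ys)%N -> `|nth 0 ys j - nth 0 zs j| <= d) ->
  `|scost s ys - scost s zs| <= d.
Proof.
move=> s0 ys0 yz dd; rewrite /scost -mulrBr normrM ger0_norm ?invr_ge0//.
rewrite ler_pdivrMl ?ltr0n// -sumrB.
apply: (le_trans (ler_norm_sum _ _ _)).
apply: (@le_trans _ _ (\sum_(x <- s) d)).
  by apply: ler_sum => x _; exact: mindist_close.
by rewrite big_const_seq count_predT iter_addr_0 mulr_natl.
Qed.

Lemma scost_opt_lipschitz (k n : nat) : (0 < k)%N -> (0 < n)%N ->
  lipschitz_seq n 1 (@scost_opt k).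
Proof.
move=> k0 n0; have B u w : size u = n -> size w = n ->
    scost_opt k u <= scost_opt k w + l1dist u w.
  move=> un wn; rewrite -lerBlDr; apply: le_scost_opt => // ys ysk.
  rewrite lerBlDr; apply: (le_trans (scost_opt_le u k0 ysk)).
  have := @scost_lipschitz u w ys; rewrite ysk un wn => /(_ k0 n0 erefl)/ler_normlP[].
  lra.
move=> s t sn tn; rewrite mul1r; apply/ler_normlP; rewrite opprB !lerBlDr; split.
  by rewrite l1distC [leRHS]addrC B.
by rewrite [leRHS]addrC B.
Qed.

Definition ostat s (r : nat) : R := nth 0 (sort <=%R s) r.

(** In a sorted list the entries satisfying a downward closed predicate form an initial segment.
    This turns events about order statistics into counts, that is, into values of the empirical
    c.d.f. *)
Lemma nth_sorted_count (P : pred R) t (r : nat) :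
  (forall x y, x <= y -> P y -> P x) -> sorted <=%R t -> (r < size t)%N ->
  P (nth 0 t r) = (r < count P t)%N.
Proof.
move=> PP; elim: t r => [//|x t IH] r st rt.
have sx := order_path_min le_trans st.
rewrite /=; case: (boolP (P x)) => Px.
  case: r rt => [|r] rt /=; first by rewrite Px.
  by rewrite IH ?add1n//; exact: path_sorted st.
have nPt y : y \in t -> ~~ P y.
  by move=> yt; apply: contra Px; apply: PP; exact: (allP sx).
have -> : count P t = 0%N.
  by apply/eqP; rewrite -leqn0 leqNgt -has_count; apply/hasPn.
case: r rt => [|r] rt /=; first exact/negbTE.
by apply/negbTE/nPt; rewrite mem_nth.
Qed.

Lemma ostat_count (P : pred R) s (r : nat) :
  (forall x y, x <= y -> P y -> P x) -> (r < size s)%N ->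
  P (ostat s r) = (r < count P s)%N.
Proof.
move=> PP rs; rewrite /ostat nth_sorted_count ?size_sort//.
  by rewrite (permP (permEl (perm_sort <=%R s))).
by apply: sort_sorted; exact: le_total.
Qed.

Lemma ostat_le s (r : nat) a : (r < size s)%N ->
  (ostat s r <= a) = (r < count (fun x => x <= a)%R s)%N.
Proof. by move=> rs; apply: ostat_count rs => x y /le_trans; exact. Qed.

Lemma ostat_lt s (r : nat) a : (r < size s)%N ->
  (ostat s r < a) = (r < count (fun x => x < a)%R s)%N.
Proof. by move=> rs; apply: ostat_count rs => x y /le_lt_trans; exact. Qed.

(** Matching entries differ by at most d, the l1 distance, so raising a threshold by d in one list
    keeps at least the count of the other ([cnt]). *)
Lemma ostat_lipschitz s t (r : nat) : size s = size t -> (r < size s)%N ->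
  `|ostat s r - ostat t r| <= l1dist s t.
Proof.
have cnt d u w a : size u = size w -> l1dist u w <= d ->
   (count (fun x => x <= a)%R u <= count (fun x => x <= a + d)%R w)%N.
  elim: u w => [|x u IH] [|y w] //= [uw].
  rewrite l1dist_cons => h; apply: leq_add; last first.
    by apply: IH => //; apply: le_trans h; rewrite lerDr.
  have : y <= x + d.
    by have := l1dist_ge0 u w; have := ler_norm (y - x); rewrite distrC; lra.
  by case: (leP x a) => xa yx //; case: (leP y (a + d)) => //; lra.
have B u w : size u = size w -> (r < size u)%N -> ostat w r <= ostat u r + l1dist u w.
  move=> uw ru; rewrite ostat_le -?uw//.
  by apply: leq_trans (cnt _ _ _ _ uw (lexx _)); rewrite -ostat_le.
move=> st rs; apply/ler_normlP; rewrite opprB !lerBlDr; split.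
  by rewrite [leRHS]addrC B.
by rewrite [leRHS]addrC l1distC B// -st.
Qed.

(** The rank is n p up to an error of order 1: passing from n - 1 to n costs p < 1, and the
    truncation is absorbed by the successor in [r.+1]. *)
Lemma percentile_index (n : nat) (p : R) : (0 < n)%N -> 0 < p < 1 ->
  let r := Num.truncn (n.-1%:R * p) in
  (r < n)%N /\ r%:R <= n%:R * p /\ n%:R * p - 1 < r.+1%:R.
Proof.
move=> n0 /andP[p0 p1] /=.
have np : 0 <= n.-1%:R * p by rewrite mulr_ge0// ltW.
have /andP[h1 h2] := truncn_itv np.
have nE : n%:R = n.-1%:R + 1 :> R by rewrite natr1 prednK.
split; last first.
  by split; rewrite nE mulrDl mul1r; [apply: le_trans h1 _; lra|lra].
rewrite -(@ltr_nat R); apply: le_lt_trans h1 _; rewrite nE.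
have : n.-1%:R * p <= n.-1%:R by rewrite ler_piMr// ltW.
lra.
Qed.

Lemma nth_PM (v s : seq R) j : (j < size v)%N ->
  nth 0 (PM v s) j = ostat s (Num.truncn ((size s).-1%:R * nth 0 v j)).
Proof. by move=> jv; rewrite (nth_map 0). Qed.

(** The sample enters twice, as the agents and, through order statistics, as the facilities; each
    role contributes 1 to the constant. *)
Lemma scost_PM_lipschitz (v : seq R) (n : nat) : (0 < size v)%N -> (0 < n)%N ->
  (forall p, p \in v -> 0 < p < 1) ->
  lipschitz_seq n 2 (fun s => scost s (PM v s)).
Proof.
move=> v0 n0 v01 s t sn tn.
have st : size s = size t by rewrite sn tn.
have sPM u : size (PM v u) = size v by rewrite size_map.
have h1 : `|scost s (PM v s) - scost t (PM v s)| <= l1dist s t.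
  by apply: scost_lipschitz; rewrite ?sPM ?sn.
have h2 : `|scost t (PM v s) - scost t (PM v t)| <= l1dist s t.
  apply: scost_close; rewrite ?sPM ?tn// => j jv.
  rewrite !nth_PM// -st; apply: ostat_lipschitz => //.
  by rewrite sn; case: (@percentile_index n (nth 0 v j) n0 (v01 _ (mem_nth 0 jv))).
have := ler_distD (scost t (PM v s)) (scost s (PM v s)) (scost t (PM v t)); lra.
Qed.

End SocialCost.

(** * Empirical c.d.f. and concentration of order statistics *)

Section EmpiricalCdf.
Context {R : realType} (mu : probability R R).

Lemma cdf_ge0 t : 0 <= cdf mu t.
Proof. by rewrite /cdf fine_ge0. Qed.

Lemma cdf_has_mean (t : R) : has_mean mu (fun x => (x <= t)%R%:R) (cdf mu t).
Proof.
have -> : (fun x : R => (x <= t)%R%:R) = \1_([set` `]-oo, t]]) :> (R -> R).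
  apply/funext => x; rewrite indicE; congr (_%:R).
  by rewrite mem_setE in_itv/=.
have mt : measurable [set` `]-oo, t]] by exact: measurable_itv.
split.
  apply: (@measurable_bounded_integrable _ _ _ mu) => //.
  - by apply: (@le_lt_trans _ _ 1%E); [exact: probability_le1|exact: ltry].
  - exists 1; split => // r r1 x _ /=.
    by rewrite indicE ger0_norm// (le_trans _ (ltW r1))// lern1; case: (_ \in _).
by rewrite /Rintegral integral_indic// setIT.
Qed.

Lemma cdf_le1 t : cdf mu t <= 1.
Proof.
apply: has_mean_le (cdf_has_mean t) (has_mean_cst mu 1) _ => x.
by rewrite lern1; case: (_ <= _).
Qed.

Lemma cdf_mono s t : s <= t -> cdf mu s <= cdf mu t.
Proof.
move=> st; apply: has_mean_le (cdf_has_mean s) (cdf_has_mean t) _ => x.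
by rewrite ler_nat; case: (leP x s) => // xs; rewrite (le_trans xs st).
Qed.

Definition centered_ind (t x : R) : R := (x <= t)%R%:R - cdf mu t.

Lemma centered_ind_has_mean t : has_mean mu (centered_ind t) 0.
Proof.
have := has_meanD (cdf_has_mean t) (has_mean_cst mu (- cdf mu t)).
by rewrite subrr.
Qed.

(** An indicator equals its own square, so the square is affine in the indicator; the mean is the
    Bernoulli variance. *)
Lemma centered_ind_sqr_has_mean t :
  has_mean mu (fun x => centered_ind t x ^+ 2) (cdf mu t * (1 - cdf mu t)).
Proof.
have := has_meanD (has_meanZ (1 - 2 * cdf mu t) (cdf_has_mean t))
  (has_mean_cst mu (cdf mu t ^+ 2)).
have -> : (1 - 2 * cdf mu t) * cdf mu t + cdf mu t ^+ 2 =
  cdf mu t * (1 - cdf mu t) by ring.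
congr has_mean; apply/funext => x; rewrite /centered_ind.
by case: (x <= t) => /=; ring.
Qed.

(** This is F_n(t) - F(t), written as an average of centred terms so that [has_iid_mean_square]
    gives the mean of its square. *)
Definition cdf_dev (t : R) (s : seq R) : R :=
  (size s)%:R^-1 * \sum_(x <- s) centered_ind t x.

Lemma cdf_devE t s : (0 < size s)%N ->
  cdf_dev t s = (count (fun x => x <= t)%R s)%:R / (size s)%:R - cdf mu t.
Proof.
move=> s0; rewrite /cdf_dev big_split/= sumrN.
have -> : \sum_(x <- s) (x <= t)%R%:R = (count (fun x => x <= t)%R s)%:R :> R.
  by rewrite -natr_sum -sum1_count -big_mkcond.
rewrite big_const_seq count_predT iter_addr_0 mulrBr mulrC; congr (_ - _).
by rewrite -[cdf mu t *+ _]mulr_natl mulrA mulVf ?mul1r// pnatr_eq0 -lt0n.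
Qed.

Lemma cdf_dev_sqr_has_mean (n : nat) t : (0 < n)%N ->
  has_iid_mean mu n (fun s => cdf_dev t s ^+ 2) (cdf mu t * (1 - cdf mu t) / n%:R).
Proof.
move=> n0; have n0' : n%:R != 0 :> R by rewrite pnatr_eq0 -lt0n.
have := has_iid_meanZ (n%:R^-1 ^+ 2) (has_iid_mean_square n 0
  (centered_ind_has_mean t) (centered_ind_sqr_has_mean t)).
have -> : n%:R^-1 ^+ 2 * (0 ^+ 2 + n%:R * (cdf mu t * (1 - cdf mu t))) =
  cdf mu t * (1 - cdf mu t) / n%:R by field.
apply: eq_has_iid_mean => s sn; rewrite /cdf_dev sn add0r; ring.
Qed.

Lemma dyadic_scale (h z : R) (M : nat) : h < z -> z <= h * 2 ^+ M ->
  exists2 m, (m < M)%N & h * 2 ^+ m < z <= h * 2 ^+ m.+1.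
Proof.
move=> hz; elim: M => [|M IH] zM; first by rewrite mulr1 in zM; lra.
have [/IH [m mM mz]|zM'] := leP z (h * 2 ^+ M); last by exists M; rewrite // zM'.
by exists m => //; rewrite ltnS ltnW.
Qed.

Lemma sum_half_powers (M : nat) : \sum_(m < M) (2 ^+ m)^-1 <= 2 :> R.
Proof.
suff -> : \sum_(m < M) (2 ^+ m)^-1 = 2 - 2 / 2 ^+ M :> R.
  by rewrite lerBlDr lerDl divr_ge0// exprn_ge0.
elim: M => [|M IH]; first by rewrite big_ord0; field.
by rewrite big_ord_recr/= IH exprS; field; rewrite expf_neq0.
Qed.

Lemma sum_sqr_dev_ge (s : seq R) (P : pred R) (q d : R) :
  (forall x, P x -> d ^+ 2 <= (x - q) ^+ 2) ->
  (count P s)%:R * d ^+ 2 <= \sum_(x <- s) (x - q) ^+ 2.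
Proof.
move=> Pd; elim: s => [|x s IH]; first by rewrite big_nil mul0r.
rewrite big_cons /= natrD mulrDl lerD//.
case: (boolP (P x)) => [/Pd|_]; first by rewrite mul1r.
by rewrite mul0r sqr_ge0.
Qed.

Variables (p q c e : R).
Hypotheses (p01 : 0 < p < 1) (c0 : 0 < c) (e0 : 0 < e).
Hypothesis cdf_right : forall t : R, 0 < t <= e -> p + c * t <= cdf mu (q + t).
Hypothesis cdf_left : forall t : R, 0 < t <= e -> cdf mu (q - t) <= p - c * t.

Let dev2 (t : R) (s : seq R) : R := cdf_dev (q + t) s ^+ 2 + cdf_dev (q - t) s ^+ 2.

Section fixed_n.
Variables (n : nat) (h : R).
Hypotheses (n0 : (0 < n)%N) (h0 : 0 < h) (hn : h ^+ 2 = n%:R^-1).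
Hypotheses (hc : h <= c / 2) (np : 2 <= n%:R * p).
Let r := Num.truncn (n.-1%:R * p).

Let nR0 : 0 < n%:R :> R. Proof. by rewrite ltr0n. Qed.

(** The deterministic half of Chebyshev's inequality. If the order statistic exceeds q + t, then
    F_n(q + t) <= r / n <= p, whereas F(q + t) >= p + c t. If it is below q - t, then F_n(q - t) >=
    p - 1/n, whereas F(q - t) <= p - c t; the slack 1/n = h^2 is at most c t / 2 because h <= c / 2
    and h <= t, whence the factor 1/2. *)
Lemma ostat_dev_chebyshev (s : seq R) (t : R) : size s = n -> h <= t <= e ->
  t < `|ostat s r - q| -> (c * t / 2) ^+ 2 <= dev2 t s.
Proof.
move=> sn /andP[ht te]; have t0 : 0 < t := lt_le_trans h0 ht.
have [rn [rp1 rp2]] := percentile_index n0 p01.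
rewrite -/r in rn rp1 rp2.
have ct : 0 <= c * t / 2 by rewrite divr_ge0// mulr_ge0// ltW.
rewrite ltr_normr => /orP[Y|Y].
  have YY : q + t < ostat s r by lra.
  have : (count (fun x => x <= q + t)%R s <= r)%N.
    by rewrite leqNgt -ostat_le ?sn// -ltNge.
  rewrite -(ler_nat R) => cr.
  have d : c * t / 2 <= - cdf_dev (q + t) s.
    rewrite cdf_devE ?sn//.
    have : (count (fun x => x <= q + t)%R s)%:R / n%:R <= p.
      by rewrite ler_pdivrMr// mulrC; lra.
    have := @cdf_right t; rewrite t0 te => /(_ isT).
    have : 0 < c * t by rewrite mulr_gt0.
    lra.
  have : (c * t / 2) ^+ 2 <= (- cdf_dev (q + t) s) ^+ 2 by rewrite lerXn2r// ?nnegrE; lra.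
  by rewrite sqrrN /dev2 => /le_trans; apply; rewrite lerDl sqr_ge0.
have YY : ostat s r <= q - t by lra.
have : (r < count (fun x => x <= q - t)%R s)%N by rewrite -ostat_le ?sn.
rewrite -(ler_nat R) => cr.
have d : c * t / 2 <= cdf_dev (q - t) s.
  rewrite cdf_devE ?sn//.
  have : p - n%:R^-1 <= (count (fun x => x <= q - t)%R s)%:R / n%:R.
    rewrite ler_pdivlMr// mulrBl mulVf ?gt_eqF//; rewrite (mulrC p); lra.
  have := @cdf_left t; rewrite t0 te => /(_ isT).
  have : n%:R^-1 <= c * t / 2.
    rewrite -hn expr2; apply: (@le_trans _ _ (c / 2 * t)); last lra.
    by apply: ler_pM => //; exact: ltW.
  lra.
have : (c * t / 2) ^+ 2 <= (cdf_dev (q - t) s) ^+ 2 by rewrite lerXn2r// ?nnegrE; lra.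
by rewrite /dev2 => /le_trans; apply; rewrite lerDr sqr_ge0.
Qed.

(** If the order statistic lies at distance d to the right of q, the n - r >= n (1 - p) entries from
    it onwards are all at distance at least d from q. On the left there are at least r + 1 such
    entries, and r + 1 >= n p - 1 >= n p / 2 since n p >= 2. *)
Lemma ostat_dev_sqr (s : seq R) : size s = n ->
  (ostat s r - q) ^+ 2 <=
    ((1 - p)^-1 + 2 / p) * (n%:R^-1 * \sum_(x <- s) (x - q) ^+ 2).
Proof.
move=> sn; have /andP[p0 p1] := p01.
have [rn [rp1 rp2]] := percentile_index n0 p01.
rewrite -/r in rn rp1 rp2.
set d := ostat s r - q; set S := \sum_(x <- s) _.
have S0 : 0 <= S by rewrite sumr_ge0// => x _; rewrite sqr_ge0.
suff [k k0 [kS kd]] : exists2 k : R, 0 < k &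
    k <= (1 - p)^-1 + 2 / p /\ n%:R * d ^+ 2 <= k * S.
  have : d ^+ 2 <= k * (n%:R^-1 * S) by rewrite mulrCA ler_pdivlMl.
  by move=> /le_trans; apply; rewrite ler_wpM2r// mulr_ge0// invr_ge0 ltW.
have ip : 0 < 2 / p by rewrite divr_gt0.
have i1p : 0 < (1 - p)^-1 by rewrite invr_gt0; lra.
have [Yq|Yq] := leP q (ostat s r).
  exists ((1 - p)^-1) => //; split; first lra.
  rewrite ler_pdivlMl; last lra.
  have H : (count (fun x => ostat s r <= x)%R s)%:R * d ^+ 2 <= S.
    apply: sum_sqr_dev_ge => x Yx; rewrite /d lerXn2r// ?nnegrE; lra.
  apply: le_trans H; rewrite mulrA ler_wpM2r ?sqr_ge0//.
  have : (count (fun x => x < ostat s r)%R s <= r)%N.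
    by rewrite leqNgt -ostat_lt ?sn// ltxx.
  have := count_predC (fun x => x < ostat s r)%R s.
  rewrite sn => cn; rewrite -(ler_nat R) => cr.
  have -> : count (fun x => ostat s r <= x)%R s = count (predC (fun x => x < ostat s r)%R) s.
    by apply: eq_count => x /=; rewrite leNgt.
  have : n%:R = (count (fun x => x < ostat s r)%R s)%:R +
     (count (predC (fun x => x < ostat s r)%R) s)%:R :> R by rewrite -natrD cn.
  by move=> nE; rewrite mulrBl mul1r (mulrC p); lra.
exists (2 / p) => //; split; first lra.
have H : (count (fun x => x <= ostat s r)%R s)%:R * d ^+ 2 <= S.
  apply: sum_sqr_dev_ge => x Yx; rewrite /d -sqrrN -[leRHS]sqrrN lerXn2r// ?nnegrE; lra.
have -> : 2 / p * S = (p / 2)^-1 * S by rewrite invf_div.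
rewrite ler_pdivlMl; last lra.
apply: le_trans H; rewrite mulrA ler_wpM2r ?sqr_ge0//.
have : (r < count (fun x => x <= ostat s r)%R s)%N by rewrite -ostat_le ?sn.
rewrite -(ler_nat R) => /(le_trans _); apply.
have -> : p / 2 * n%:R = n%:R * p / 2 by ring.
by move: rp2 np; move: (r.+1%:R) (n%:R * p) => x y; lra.
Qed.

(* The sum handles deviations at scales h 2^m <= e by Chebyshev's inequality; a
   deviation Z > e is controlled through Z <= h Z^2 / 2 + 1 / (2 h). *)
Definition ostat_bound (M : nat) (s : seq R) : R :=
  h + \sum_(m < M) (8 / (c ^+ 2 * h) / 2 ^+ m) * dev2 (h * 2 ^+ m) s +
  h / 2 * (((1 - p)^-1 + 2 / p) * (n%:R^-1 * \sum_(x <- s) (x - q) ^+ 2)) +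
  2 / (h * (c * e) ^+ 2) * dev2 e s.

Lemma ostat_le_bound (M : nat) (s : seq R) : e <= h * 2 ^+ M -> h <= e ->
  size s = n -> `|ostat s r - q| <= ostat_bound M s.
Proof.
move=> eM he sn; rewrite /ostat_bound.
have dev20 t : 0 <= dev2 t s by rewrite addr_ge0// sqr_ge0.
set A : R := \sum_(_ < _) _; set B : R := h / 2 * _; set D : R := _ * dev2 e s.
set Z : R := `|_|.
have A0 : 0 <= A.
  apply: sumr_ge0 => m _; rewrite mulr_ge0// !divr_ge0//.
  by rewrite mulr_ge0 ?sqr_ge0// ltW.
have ZB : h / 2 * Z ^+ 2 <= B.
  rewrite ler_wpM2l//; first by rewrite divr_ge0// ltW.
  by rewrite /Z real_normK ?num_real// ostat_dev_sqr.
have D0 : 0 <= D.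
  by rewrite mulr_ge0// divr_ge0// mulr_ge0 ?sqr_ge0// ltW.
have B0 : 0 <= B.
  by apply: le_trans ZB; rewrite mulr_ge0 ?sqr_ge0// divr_ge0// ltW.
have gen (x y z w : R) : 0 <= x -> 0 <= z -> 0 <= w -> y <= x + y + z + w by lra.
have [Zh|hZ] := leP Z h; first lra.
have [Ze|eZ] := leP Z e.
  have [m mM /andP[m1 m2]] := dyadic_scale hZ (le_trans Ze eM).
  have : Z <= A.
    rewrite /A (bigD1 (Ordinal mM))//=.
    apply: (@le_trans _ _ (8 / (c ^+ 2 * h) / 2 ^+ m * dev2 (h * 2 ^+ m) s)); last first.
      rewrite lerDl; apply: sumr_ge0 => j _; rewrite mulr_ge0// !divr_ge0//.
      by rewrite mulr_ge0 ?sqr_ge0// ltW.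
    have hm : h <= h * 2 ^+ m <= e.
      by rewrite ler_peMr ?exprn_ege1 ?ler1n//; [rewrite (le_trans (ltW m1))|exact: ltW].
    have := ostat_dev_chebyshev sn hm m1 => cheb.
    apply: (le_trans m2).
    (* The coefficient in [ostat_bound] is the one that turns the lower bound on [dev2] at scale m
       into the next scale, which bounds the deviation. *)
    have -> : h * 2 ^+ m.+1 = 8 / (c ^+ 2 * h) / 2 ^+ m * (c * (h * 2 ^+ m) / 2) ^+ 2.
      by rewrite exprS; field; rewrite ?expf_neq0 ?gt_eqF.
    rewrite ler_wpM2l// !divr_ge0//.
    by rewrite mulr_ge0 ?sqr_ge0// ltW.
  by move=> /le_trans; apply; exact: gen (ltW h0) B0 D0.
have hee : h <= e <= e by rewrite he lexx.
have := ostat_dev_chebyshev sn hee eZ => cheb.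
have : 2 / (h * (c * e) ^+ 2) * (c * e / 2) ^+ 2 <= D.
  by rewrite ler_wpM2l// divr_ge0// mulr_ge0 ?sqr_ge0// ltW.
have -> : 2 / (h * (c * e) ^+ 2) * (c * e / 2) ^+ 2 = (2 * h)^-1.
  by field; rewrite !gt_eqF.
move=> hD.
have : Z <= h / 2 * Z ^+ 2 + (2 * h)^-1.
  rewrite -subr_ge0.
  have -> : h / 2 * Z ^+ 2 + (2 * h)^-1 - Z = (h * Z - 1) ^+ 2 * (2 * h)^-1.
    by field; rewrite gt_eqF.
  by rewrite mulr_ge0 ?sqr_ge0// invr_ge0 mulr_ge0// ltW.
move=> /le_trans; apply; apply: (le_trans (lerD ZB hD)).
by rewrite lerD2r lerDr addr_ge0// ltW.
Qed.

Lemma cdf_var_le t : cdf mu t * (1 - cdf mu t) / n%:R <= h ^+ 2.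
Proof.
rewrite hn ler_pdivrMr// mulVf ?gt_eqF//.
have := cdf_ge0 t; have := cdf_le1 t; nra.
Qed.

(** Chebyshev gives scale h 2^m a probability of order 4^(-m), so the scales contribute a geometric
    series, at most 32 h / c^2 whatever [M] is. *)
Lemma ostat_bound_mean (M : nat) (m2 : R) : has_mean mu (fun x => (x - q) ^+ 2) m2 ->
  exists2 a, has_iid_mean mu n (ostat_bound M) a &
  a <= (1 + 32 / c ^+ 2 + ((1 - p)^-1 + 2 / p) * m2 / 2 + 4 / (c * e) ^+ 2) * h.
Proof.
move=> hm2.
pose var t := cdf mu t * (1 - cdf mu t) / n%:R.
have dev2m t : has_iid_mean mu n (dev2 t) (var (q + t) + var (q - t)).
  by apply: has_iid_meanD; exact: cdf_dev_sqr_has_mean.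
have dev2b t : var (q + t) + var (q - t) <= 2 * h ^+ 2.
  by rewrite mulr_natl mulr2n lerD// cdf_var_le.
eexists.
  apply: has_iid_meanD; last exact/has_iid_meanZ/dev2m.
  apply: has_iid_meanD; last first.
    do 3 apply: has_iid_meanZ.
    apply: eq_has_iid_mean (has_iid_mean_linear n 0 hm2) => s _.
    by rewrite add0r.
  apply: has_iid_meanD; first exact: has_iid_mean_cst.
  by apply: has_iid_mean_sum => m; exact/has_iid_meanZ/dev2m.
rewrite add0r mulKf ?gt_eqF//.
set A := \sum_(_ <- _) _.
have hA : A <= 32 / c ^+ 2 * h.
  apply: (@le_trans _ _ (\sum_(m < M) (16 / c ^+ 2 * h) * (2 ^+ m)^-1)).
    apply: ler_sum => m _.
    have -> : 16 / c ^+ 2 * h / 2 ^+ m = 8 / (c ^+ 2 * h) / 2 ^+ m * (2 * h ^+ 2).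
      by field; rewrite ?expf_neq0 ?gt_eqF.
    by rewrite ler_wpM2l// !divr_ge0// mulr_ge0 ?sqr_ge0// ltW.
  rewrite -mulr_sumr.
  have -> : 32 / c ^+ 2 * h = 16 / c ^+ 2 * h * 2 by field; rewrite gt_eqF.
  by rewrite ler_wpM2l ?sum_half_powers// mulr_ge0 ?ltW// divr_gt0// exprn_gt0.
have hD : 2 / (h * (c * e) ^+ 2) * (var (q + e) + var (q - e)) <= 4 / (c * e) ^+ 2 * h.
  have -> : 4 / (c * e) ^+ 2 * h = 2 / (h * (c * e) ^+ 2) * (2 * h ^+ 2).
    by field; rewrite !gt_eqF.
  by rewrite ler_wpM2l// divr_ge0// mulr_ge0 ?sqr_ge0// ltW.
lra.
Qed.

End fixed_n.

Lemma quantile_deviation (m2 : R) : has_mean mu (fun x => (x - q) ^+ 2) m2 ->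
  exists C N : R, forall n : nat, N <= n%:R ->
  exists (G : seq R -> R) (a : R), [/\ has_iid_mean mu n G a,
    a <= C / Num.sqrt n%:R &
    forall s, size s = n -> `|ostat s (Num.truncn (n.-1%:R * p)) - q| <= G s].
Proof.
move=> hm2; have /andP[p0 p1] := p01.
exists (1 + 32 / c ^+ 2 + ((1 - p)^-1 + 2 / p) * m2 / 2 + 4 / (c * e) ^+ 2).
(* The summands ensure in turn n > 0, h <= c / 2, h <= e and 2 <= n p. *)
exists (1 + (2 / c) ^+ 2 + (e^-1) ^+ 2 + 2 / p) => n nN.
have u1 : 0 <= (2 / c) ^+ 2 by rewrite sqr_ge0.
have u2 : 0 <= (e^-1) ^+ 2 by rewrite sqr_ge0.
have u3 : 0 < 2 / p by rewrite divr_gt0.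
have nR : 0 < n%:R :> R by lra.
have n0 : (0 < n)%N by rewrite -(ltr0n R).
have sn : 0 < Num.sqrt n%:R :> R by rewrite sqrtr_gt0.
pose h : R := (Num.sqrt n%:R)^-1.
have h0 : 0 < h by rewrite invr_gt0.
have hn : h ^+ 2 = n%:R^-1 by rewrite exprVn sqr_sqrtr// ltW.
have hle (x : R) : 0 < x -> (x^-1) ^+ 2 <= n%:R -> h <= x.
  move=> x0 xn; rewrite -[x]invrK /h lef_pV2 ?posrE ?invr_gt0//.
  have -> : x^-1 = Num.sqrt (x^-1 ^+ 2).
    by rewrite sqrtr_sqr ger0_norm// invr_ge0 ltW.
  exact: ler_wsqrtr.
have hc : h <= c / 2 by apply: hle; rewrite ?divr_gt0// invf_div; lra.
have he : h <= e by apply: hle => //; lra.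
have np : 2 <= n%:R * p by rewrite -ler_pdivrMr//; lra.
(* Enough dyadic scales to pass e, since 2^M >= M > e / h. Their number grows with n, but the bound
   on the mean does not depend on it. *)
pose M := (Num.truncn (e / h)).+1.
have eM : e <= h * 2 ^+ M.
  rewrite -ler_pdivrMl// mulrC.
  have eh0 : 0 <= e / h by rewrite divr_ge0// ltW.
  have /andP[_ /ltW/le_trans] := truncn_itv eh0; apply.
  have : (M <= 2 ^ M)%N by exact: ltnW (ltn_expl M (isT : (1 < 2)%N)).
  by rewrite -(ler_nat R) natrX.
have [a Ga ab] := ostat_bound_mean n0 h0 hn M hm2.
exists (ostat_bound n h M), a; split => // s ss.
exact: ostat_le_bound.
Qed.

End EmpiricalCdf.

(** * Deviation of empirical means, uniformly over 1-Lipschitz functions *)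

Section UniformDeviation.
Context {R : realType} (mu : probability R R).
Implicit Types (f : R -> R) (s : seq R).

(* A 1-Lipschitz f is replaced by a step function on a grid of mesh h, uniformly
   in f: the deviation of its mean is then a sum of deviations of the cdf. *)
Definition step_approx f (t0 h : R) (M : nat) (x : R) : R :=
  f t0 + \sum_(m < M) (f (t0 + m.+1%:R * h) - f (t0 + m%:R * h)) *
    (1 - (x <= t0 + m.+1%:R * h)%R%:R).

(** With nodes t_m = t0 + m h, the approximant is f(t_m) on ]t_m, t_(m+1)] and constant outside the
    grid. The first conclusion gives the induction its value on the cell being added. *)
Lemma step_approx_err f (t0 h : R) (M : nat) (x : R) : lipschitz1 1 f -> 0 < h ->
  (t0 + M%:R * h < x -> step_approx f t0 h M x = f (t0 + M%:R * h)) /\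
  (x <= t0 + M%:R * h ->
    `|f x - step_approx f t0 h M x| <= h + Num.max 0 (t0 - x)).
Proof.
move=> fL h0; elim: M => [|M [IH1 IH2]].
  rewrite /step_approx big_ord0 mul0r !addr0; split => // xt.
  apply: (le_trans (fL x t0)); rewrite mul1r distrC ger0_norm ?subr_ge0//.
  by rewrite (le_trans _ (_ : Num.max 0 (t0 - x) <= _)) ?le_max ?lexx ?orbT// lerDr ltW.
have tS : t0 + M.+1%:R * h = t0 + M%:R * h + h by rewrite -natr1; ring.
have gS : step_approx f t0 h M.+1 x = step_approx f t0 h M x +
    (f (t0 + M.+1%:R * h) - f (t0 + M%:R * h)) * (1 - (x <= t0 + M.+1%:R * h)%R%:R).
  by rewrite /step_approx big_ord_recr/= addrA.
split => xt.
  rewrite gS leNgt xt/= subr0 mulr1 IH1; first by ring.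
  by apply: lt_trans xt; rewrite tS ltrDl.
rewrite gS xt subrr mulr0 addr0; have [/IH2//|xM] := leP x (t0 + M%:R * h).
rewrite IH1//; apply: (le_trans (fL x _)); rewrite mul1r ger0_norm ?subr_ge0 ?(ltW xM)//.
apply: (@le_trans _ _ h); first by rewrite tS in xt; lra.
by rewrite lerDl le_max lexx.
Qed.

(** On a grid from -1/h to 1/h, the error outside the grid is at most |x| - 1/h, hence at most h
    x^2, which the second moment controls. *)
Lemma step_approx_err_sqr f (h : R) (M : nat) (x : R) : lipschitz1 1 f -> 0 < h ->
  - h^-1 + M%:R * h = h^-1 ->
  `|f x - step_approx f (- h^-1) h M x| <= h + h * x ^+ 2.
Proof.
move=> fL h0 ME; have [H1 H2] := step_approx_err (- h^-1) M x fL h0.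
have key (y : R) : y - h^-1 <= h * y ^+ 2.
  rewrite -subr_ge0.
  have -> : h * y ^+ 2 - (y - h^-1) = h * ((y - h^-1 / 2) ^+ 2 + 3 / 4 * (h^-1) ^+ 2).
    by field; rewrite gt_eqF.
  by rewrite mulr_ge0 ?ltW// ltr_wpDl ?sqr_ge0// mulr_gt0// exprn_gt0// invr_gt0.
rewrite ME in H1 H2.
have [xM|xM] := leP x h^-1.
  apply: (le_trans (H2 xM)); rewrite lerD2l ge_max.
  rewrite mulr_ge0 ?sqr_ge0 ?(ltW h0)//=.
  by rewrite -sqrrN; have := key (- x); rewrite addrC.
rewrite H1//; apply: (le_trans (fL x _)); rewrite mul1r ger0_norm ?subr_ge0 ?(ltW xM)//.
by apply: (le_trans (key x)); rewrite lerDr ltW.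
Qed.

Lemma step_approx_mean f (t0 h : R) (M : nat) :
  has_mean mu (step_approx f t0 h M)
   (f t0 + \sum_(m < M) (f (t0 + m.+1%:R * h) - f (t0 + m%:R * h)) *
      (1 - cdf mu (t0 + m.+1%:R * h))).
Proof.
apply: has_meanD; first exact: has_mean_cst.
elim: M => [|M IH].
  rewrite big_ord0; have := has_mean_cst mu 0.
  by congr has_mean; apply/funext => x; rewrite big_ord0.
rewrite big_ord_recr/=; under eq_fun do rewrite big_ord_recr/=.
apply: has_meanD => //; apply: has_meanZ.
apply: has_meanD; first exact: has_mean_cst.
have := has_meanZ (-1) (cdf_has_mean mu (t0 + M.+1%:R * h)).
rewrite mulN1r; congr has_mean; apply/funext => x.
by rewrite mulN1r.
Qed.

(** Passing to the step function in the true and in the empirical mean costs the first three terms.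
    What remains is a sum of grid increments of [f], each at most h in absolute value, times values
    of F_n - F; so [f] disappears from the bound. *)
Lemma lipschitz_deviation f (fm m2 h : R) (M : nat) s :
  lipschitz1 1 f -> has_mean mu f fm -> has_mean mu (fun x => x ^+ 2) m2 ->
  0 < h -> - h^-1 + M%:R * h = h^-1 -> (0 < size s)%N ->
  fm - (size s)%:R^-1 * \sum_(x <- s) f x <=
   2 * h + h * m2 + h * ((size s)%:R^-1 * \sum_(x <- s) x ^+ 2) +
   \sum_(m < M) h * `|cdf_dev mu (- h^-1 + m.+1%:R * h) s|.
Proof.
move=> fL fmE m2E h0 ME s0.
have err x := step_approx_err_sqr x fL h0 ME.
have nR0 : 0 < (size s)%:R :> R by rewrite ltr0n.
set g := step_approx f (- h^-1) h M in err.
pose t m : R := - h^-1 + m%:R * h.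
have gmE := step_approx_mean f (- h^-1) h M; rewrite -/g in gmE.
set gm := (X in has_mean mu g X) in gmE.
have le1 : fm <= gm + (h + h * m2).
  apply: has_mean_le fmE (has_meanD gmE (has_meanD (has_mean_cst mu h) (has_meanZ h m2E))) _.
  by move=> x; have /ler_normlP[] := err x; lra.
pose Gn := (size s)%:R^-1 * \sum_(x <- s) g x.
have le2 : Gn - (h + h * ((size s)%:R^-1 * \sum_(x <- s) x ^+ 2)) <=
    (size s)%:R^-1 * \sum_(x <- s) f x.
  rewrite lerBlDr.
  have -> : h + h * ((size s)%:R^-1 * \sum_(x <- s) x ^+ 2) =
     (size s)%:R^-1 * \sum_(x <- s) (h + h * x ^+ 2).
    rewrite big_split/= -mulr_sumr big_const_seq count_predT iter_addr_0.
    by rewrite mulrDr -[h *+ _]mulr_natl mulKf ?gt_eqF// mulrCA.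
  rewrite -mulrDr -big_split/= ler_wpM2l ?invr_ge0 ?(ltW nR0)//.
  by apply: ler_sum => x _; have /ler_normlP[] := err x; lra.
have le3 : gm - Gn <= \sum_(m < M) h * `|cdf_dev mu (t m.+1) s|.
  have -> : gm - Gn = \sum_(m < M) (f (t m.+1) - f (t m)) * cdf_dev mu (t m.+1) s.
    rewrite /gm /Gn /g /step_approx big_split/= mulrDr.
    rewrite big_const_seq count_predT iter_addr_0 -[f _ *+ _]mulr_natl mulKf ?gt_eqF//.
    rewrite exchange_big/= opprD addrACA subrr add0r mulr_sumr -sumrB.
    apply: eq_bigr => m _; rewrite -!/(t _) -mulr_sumr mulrCA -mulrBr; congr (_ * _).
    rewrite cdf_devE// sumrB big_const_seq count_predT iter_addr_0.
    have -> : \sum_(x <- s) (x <= t m.+1)%R%:R = (count (fun x => x <= t m.+1)%R s)%:R :> R.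
      by rewrite -natr_sum -sum1_count -big_mkcond.
    rewrite mulrBr mulVf ?gt_eqF// [_^-1 * _]mulrC; ring.
  apply: ler_sum => m _; apply: (le_trans (ler_norm _)); rewrite normrM.
  rewrite ler_wpM2r//; apply: (le_trans (fL _ _)); rewrite mul1r.
  have -> : t m.+1 - t m = h by rewrite /t -natr1; ring.
  by rewrite gtr0_norm.
have -> : \sum_(m < M) h * `|cdf_dev mu (- h^-1 + m.+1%:R * h) s| =
  \sum_(m < M) h * `|cdf_dev mu (t m.+1) s| by [].
set E := \sum_(_ < _) _ in le3 *; lra.
Qed.

(** Comparison of one term of a Riemann sum with the integral of x^(-1-p) over [a, a + h], derived
    from ln (1 + x) <= x and exp x >= 1 + x. *)
Lemma powR_telescope (p a h : R) : 0 < p -> 0 < a -> 0 < h ->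
  h * (a + h) `^ (- (1 + p)) <= p^-1 * (a `^ (- p) - (a + h) `^ (- p)).
Proof.
move=> p0 a0 h0; set b := a + h; have b0 : 0 < b by rewrite addr_gt0.
rewrite ler_pdivlMl//.
have -> : b `^ (- (1 + p)) = b^-1 * b `^ (- p).
  by rewrite opprD powRD ?(gt_eqF b0) ?implybT// powR_inv1// ltW.
have -> : a `^ (- p) = b `^ (- p) * expR (p * (ln b - ln a)).
  by rewrite /powR !gt_eqF// -expRD; congr expR; ring.
have lnab : 1 - a / b <= ln b - ln a.
  have ab0 : 0 < a / b by rewrite divr_gt0.
  have := @le_ln1Dx R (a / b - 1); rewrite addrCA subrr addr0.
  rewrite lnM ?posrE ?invr_gt0// lnV ?posrE// => H.
  by have := H ltac:(lra); lra.
have ex : 1 + p * (h / b) <= expR (p * (ln b - ln a)).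
  apply: le_trans (expR_ge1Dx _); rewrite lerD2l ler_wpM2l ?(ltW p0)//.
  have -> : h / b = 1 - a / b by rewrite /b; field; rewrite gt_eqF.
  by [].
have : b `^ (- p) * (1 + p * (h / b)) <= b `^ (- p) * expR (p * (ln b - ln a)).
  by rewrite ler_wpM2l// powR_ge0.
move=> H; have -> : p * (h * (b^-1 * b `^ (- p))) = b `^ (- p) * (1 + p * (h / b)) - b `^ (- p).
  by ring.
by rewrite lerB.
Qed.

Lemma powR_sum (p h : R) (N : nat) : 0 < p -> 0 < h ->
  \sum_(i < N) h * (1 + i.+1%:R * h) `^ (- (1 + p)) <= p^-1.
Proof.
move=> p0 h0; suff : \sum_(i < N) h * (1 + i.+1%:R * h) `^ (- (1 + p)) <=
    p^-1 * (1 - (1 + N%:R * h) `^ (- p)).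
  move=> /le_trans; apply; rewrite ler_piMr ?invr_ge0 ?(ltW p0)//.
  by rewrite lerBlDr lerDl powR_ge0.
elim: N => [|N IH]; first by rewrite big_ord0 mul0r addr0 powR1 subrr mulr0.
rewrite big_ord_recr/=.
have := @powR_telescope p (1 + N%:R * h) h p0; rewrite ltr_pwDl ?mulr_ge0 ?(ltW h0)//.
move=> /(_ isT h0).
have -> : 1 + N%:R * h + h = 1 + N.+1%:R * h by rewrite -natr1; ring.
rewrite !mulrBr mulr1; rewrite mulrBr mulr1 in IH; lra.
Qed.

(** The node at 0 contributes h <= 1; the negative nodes, read backwards, and the positive ones each
    give a sum bounded by [powR_sum]. *)
Lemma powR_sum_sym (p h : R) (n : nat) : 0 < p -> 0 < h <= 1 ->
  n%:R * h = h^-1 ->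
  \sum_(m < n + n) h * (1 + `|- h^-1 + m.+1%:R * h|) `^ (- (1 + p)) <= 1 + 2 / p.
Proof.
move=> p0 /andP[h0 h1] nh; pose W (i : nat) := h * (1 + i%:R * h) `^ (- (1 + p)).
have W0 i : 0 <= W i by rewrite mulr_ge0 ?powR_ge0// ltW.
rewrite big_split_ord/=.
have -> : \sum_(i < n) h * (1 + `|- h^-1 + i.+1%:R * h|) `^ (- (1 + p)) = \sum_(i < n) W i.
  rewrite [RHS](reindex_inj rev_ord_inj)/=; apply: eq_bigr => i _.
  have -> : - h^-1 + i.+1%:R * h = - ((n - i.+1)%:R * h) by rewrite -nh natrB//; ring.
  by rewrite normrN ger0_norm// mulr_ge0// ltW.
have -> : \sum_(i < n) h * (1 + `|- h^-1 + (n + i).+1%:R * h|) `^ (- (1 + p)) =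
    \sum_(i < n) W i.+1.
  apply: eq_bigr => i _; rewrite /W -nh -addnS natrD -mulNr -mulrDl addKr.
  by rewrite ger0_norm// mulr_ge0// ltW.
have S := powR_sum n p0 h0; rewrite -/(W _) in S.
have : \sum_(i < n) W i <= \sum_(i < n.+1) W i by rewrite big_ord_recr/= lerDl.
have W0E : W 0%N = h by rewrite /W mul0r addr0 powR1 mulr1.
rewrite big_ord_recl/= W0E.
set A := \sum_(_ < _) _; set B := \sum_(_ < _) _ => H.
have HB : B <= p^-1 by exact: S.
have HC : \sum_(i < n) W i.+1 <= p^-1 by exact: S.
lra.
Qed.

(** Markov's inequality for the tail pointing away from 0: 1 - F(t) for t >= 0 and F(t) for t < 0;
    the other factor is at most 1. *)
Lemma cdf_tail (a K t : R) : 0 <= a -> has_mean mu (fun x => (1 + `|x|) `^ a) K ->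
  cdf mu t * (1 - cdf mu t) <= K * (1 + `|t|) `^ (- a).
Proof.
move=> a0 KE; have F0 := cdf_ge0 mu t; have F1 := cdf_le1 mu t.
have t1 : 0 < 1 + `|t| by rewrite ltr_pwDl.
have w0 : 0 < (1 + `|t|) `^ a by rewrite powR_gt0.
rewrite powRN ler_pdivlMr//.
have mono (x : R) : `|t| <= `|x| -> (1 + `|t|) `^ a <= (1 + `|x|) `^ a.
  by move=> tx; rewrite ge0_ler_powR ?nnegrE ?addr_ge0// lerD2l.
have wx0 (x : R) : 0 <= (1 + `|x|) `^ a by rewrite powR_ge0.
have [t0|t0] := leP 0 t.
  suff wF : (1 + `|t|) `^ a * (1 + -1 * cdf mu t) <= K.
    apply: le_trans wF; rewrite mulN1r -mulrA [X in _ * X]mulrC ler_piMl// mulr_ge0 ?(ltW w0)//.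
    by rewrite subr_ge0.
  apply: has_mean_le (has_meanZ _ (has_meanD (has_mean_cst mu 1)
    (has_meanZ (-1) (cdf_has_mean mu t)))) KE _ => x.
  case: (leP x t) => xt /=; first by rewrite mulN1r subrr mulr0.
  by rewrite mulr0 addr0 mulr1 mono// !ger0_norm  ?(ltW xt)// (le_trans t0 (ltW xt)).
suff wF : (1 + `|t|) `^ a * cdf mu t <= K.
  apply: le_trans wF; rewrite mulrC ler_wpM2l ?(ltW w0)// ler_piMr//.
  by rewrite lerBlDr lerDl.
apply: has_mean_le (has_meanZ _ (cdf_has_mean mu t)) KE _ => x.
case: (leP x t) => xt /=; last by rewrite mulr0.
rewrite mulr1 mono// !ltr0_norm ?lerN2//; exact: le_lt_trans t0.
Qed.

(** By [cdf_tail] the standard deviation of F_n(t) - F(t) is at most (K / n)^(1/2) (1 + |t|)^(-1-p)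
    with p = delta / 2; an exponent beyond 1 keeps the sum over the grid bounded in n. Since [D] is
    chosen before [f], it may be used with a configuration that depends on the sample. *)
Lemma uniform_lipschitz_deviation (delta K m2 : R) : 0 < delta ->
  has_mean mu (fun x => (1 + `|x|) `^ (2 + delta)) K ->
  has_mean mu (fun x => x ^+ 2) m2 ->
  exists C : R, forall n : nat, (0 < n)%N ->
  exists (D : seq R -> R) (a : R), [/\ has_iid_mean mu n D a,
    a <= C / Num.sqrt n%:R &
    forall f fm s, lipschitz1 1 f -> has_mean mu f fm -> size s = n ->
      fm - n%:R^-1 * \sum_(x <- s) f x <= D s].
Proof.
move=> d0 KE m2E.
have K0 : 0 < K.
  apply: lt_le_trans ltr01 _; apply: has_mean_le (has_mean_cst mu 1) KE _ => x.
  have {1}-> : 1 = 1 `^ (2 + delta) :> R by rewrite powR1.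
  rewrite ge0_ler_powR ?nnegrE ?addr_ge0 ?(ltW d0)//.
  by rewrite lerDl.
pose kap := Num.sqrt K; have kap0 : 0 < kap by rewrite sqrtr_gt0.
pose p := delta / 2; have p0 : 0 < p by rewrite divr_gt0.
exists (2 + 2 * m2 + kap * (1 + 2 / p)) => n n0.
have nR : 0 < n%:R :> R by rewrite ltr0n.
have sn : 0 < Num.sqrt n%:R :> R by rewrite sqrtr_gt0.
pose h : R := (Num.sqrt n%:R)^-1.
have h0 : 0 < h by rewrite invr_gt0.
have hn : h ^+ 2 = n%:R^-1 by rewrite exprVn sqr_sqrtr// ltW.
have h1 : 0 < h <= 1.
  rewrite h0 invf_le1//= -[leLHS]sqrtr1; apply: ler_wsqrtr.
  by rewrite ler1n.
have nh : n%:R * h = h^-1 by rewrite -[n%:R]invrK -hn; field; rewrite gt_eqF.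
(* As n h = 1/h, exactly 2 n cells of mesh h lead from -1/h to 1/h. *)
have ME : - h^-1 + (n + n)%:R * h = h^-1 by rewrite natrD mulrDl nh; ring.
pose w (m : nat) : R := (1 + `|- h^-1 + m.+1%:R * h|) `^ (- (1 + p)).
have w0 m : 0 < w m by rewrite powR_gt0// ltr_pwDl.
(* |V| <= (V^2 / al + al) / 2, with al bounding the standard deviation of V *)
pose al m := h * kap * w m.
have al0 m : 0 < al m by rewrite !mulr_gt0.
pose var (m : nat) : R := cdf mu (- h^-1 + m.+1%:R * h) *
  (1 - cdf mu (- h^-1 + m.+1%:R * h)) / n%:R.
have var_al m : var m <= al m ^+ 2.
  have := @cdf_tail (2 + delta) K (- h^-1 + m.+1%:R * h) (addr_ge0 (ler0n _ _) (ltW d0)) KE.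
  have -> : (1 + `|- h^-1 + m.+1%:R * h|) `^ (- (2 + delta)) = w m ^+ 2.
    rewrite -powR_mulrn ?(ltW (w0 m))// /w -powRrM; congr (_ `^ _).
    by rewrite /p; field.
  move=> H; rewrite /var -hn mulrC /al exprMn exprMn [kap ^+ 2]sqr_sqrtr ?(ltW K0)//.
  by rewrite -mulrA ler_wpM2l ?sqr_ge0.
pose D s : R := (2 * h + h * m2 + h * (n%:R^-1 * \sum_(x <- s) x ^+ 2)) +
  \sum_(m < n + n) ((h / 2 / al m) * cdf_dev mu (- h^-1 + m.+1%:R * h) s ^+ 2 + h / 2 * al m).
exists D; eexists; split.
- apply: has_iid_meanD.
    apply: has_iid_meanD; first exact: has_iid_mean_cst.
    do 2 apply: has_iid_meanZ.
    apply: eq_has_iid_mean (has_iid_mean_linear n 0 m2E) => s _.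
    by rewrite add0r.
  apply: has_iid_mean_sum => m; apply: has_iid_meanD; last exact: has_iid_mean_cst.
  by apply: has_iid_meanZ; exact: cdf_dev_sqr_has_mean.
- rewrite add0r mulKf ?gt_eqF// -/h.
  set A := \sum_(_ <- _) _.
  have : A <= \sum_(m < n + n) (h * kap) * (h * w m).
    apply: ler_sum => m _; rewrite -/(var m).
    have : h / 2 / al m * var m <= h / 2 / al m * al m ^+ 2.
      by rewrite ler_wpM2l// !divr_ge0// ltW.
    have -> : h / 2 / al m * al m ^+ 2 = h / 2 * al m by field; rewrite gt_eqF.
    have -> : h * kap * (h * w m) = h * al m by rewrite /al; ring.
    lra.
  rewrite -mulr_sumr => HA.
  have : h * kap * \sum_(m < n + n) h * w m <= h * kap * (1 + 2 / p).
    by rewrite ler_wpM2l ?powR_sum_sym// mulr_ge0 ?ltW.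
  move: HA; set B := _ * \sum_(_ < _) _; lra.
- move=> f fm s fL fmE ss.
  have s0 : (0 < size s)%N by rewrite ss.
  have := lipschitz_deviation fL fmE m2E h0 ME s0; rewrite ss => /le_trans; apply.
  rewrite lerD2l; apply: ler_sum => m _; set V := cdf_dev _ _ _.
  rewrite -subr_ge0.
  have -> : h / 2 / al m * V ^+ 2 + h / 2 * al m - h * `|V| =
     h / 2 / al m * (`|V| - al m) ^+ 2.
    rewrite -[V ^+ 2]real_normK ?num_real//.
    by field; rewrite gt_eqF.
  by rewrite mulr_ge0 ?sqr_ge0// !divr_ge0// ltW.
Qed.

End UniformDeviation.

(** * Support, quantiles, density and moments of mu *)

Section MeasureFacts.
Context {R : realType} (mu : probability R R).

(** A point outside the support has a null neighbourhood, hence lies in a null ball of rational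
    centre and radius 1 / (j + 1). [F] enumerates these countably many balls, with [set0] at the
    remaining indices. *)
Lemma msupportC_negligible : mu.-negligible (~` msupport mu).
Proof.
pose B (u : rat * nat) : set R := ball (ratr u.1 : R) (u.2.+1%:R^-1).
pose F (m : nat) : set R :=
  if unpickle m is Some u then (if mu (B u) == 0%E then B u else set0) else set0.
apply: (@negligibleS _ _ _ _ (\bigcup_m F m)); last first.
  apply: negligible_bigcup => m; rewrite /F.
  case: (unpickle m) => [u|]; last exact: negligible_set0.
  case: eqP => [Bu|_]; last exact: negligible_set0.
  by apply/negligibleP => //; exact: measurable_ball.
move=> x /= /existsNP[e /not_implyP[e0 /negP]].
rewrite -leNgt measure_le0 => /eqP mu0.
pose j := Num.truncn (2 / e).
have jinv : j.+1%:R^-1 < e / 2.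
  rewrite -[ltRHS]invrK ltf_pV2 ?posrE ?invr_gt0 ?divr_gt0// invf_div.
  exact: truncnS_gt.
have j0 : 0 < j.+1%:R^-1 :> R by rewrite invr_gt0.
have [i iE] : exists i : R, i = j.+1%:R^-1 by eexists.
rewrite -iE in jinv j0.
have [q qx] : exists q : rat, ratr q \in `]x - i, x + i[.
  by apply: rat_in_itvoo; lra.
move: qx; rewrite in_itv/= => /andP[q1 q2].
have BB : B (q, j) `<=` ball x e.
  move=> y; rewrite /B/= -iE !ball_itv/= !in_itv/= => /andP[y1 y2]; apply/andP; split; lra.
exists (pickle (q, j)); [exact: Logic.I|rewrite /F pickleK].
have -> : mu (B (q, j)) = 0%E.
  apply/eqP; rewrite -measure_le0 -mu0; apply: le_measure => //;
    by rewrite inE; exact: measurable_ball.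
by rewrite eqxx /B/= -iE ball_itv/= in_itv/=; apply/andP; split; lra.
Qed.

Lemma mu_disjoint_msupport (A : set R) : measurable A ->
  A `<=` ~` msupport mu -> mu A = 0%E.
Proof.
move=> mA AS; apply/negligibleP => //.
exact: negligibleS AS msupportC_negligible.
Qed.

Lemma cdf_itv (a b : R) : a <= b ->
  (mu [set` `]a, b]] = (cdf mu b - cdf mu a)%:E)%E.
Proof.
move=> ab; have ma : measurable [set` `]-oo, a]] by exact: measurable_itv.
have mb : measurable [set` `]a, b]] by exact: measurable_itv.
have E : [set` `]-oo, b]] = [set` `]-oo, a]] `|` [set` `]a, b]] :> set R.
  apply/seteqP; split => x /=; rewrite !in_itv/=.
    by move=> xb; case: (leP x a) => xa; [left|right].
  by case=> [xa|/andP[]//]; exact: le_trans ab.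
rewrite /cdf E measureU//; last first.
  apply/seteqP; split => x //=; rewrite !in_itv/= => -[xa /andP[ax _]]; lra.
rewrite fineD ?fin_num_measure// addrAC subrr add0r fineK// fin_num_measure//.
Qed.

Lemma cdf_markov_right (m1 t : R) : has_mean mu (fun x => `|x|) m1 -> 0 < t ->
  1 - cdf mu t <= m1 / t.
Proof.
move=> m1E t0; rewrite ler_pdivlMr// mulrC.
have := has_meanZ t (has_meanD (has_mean_cst mu 1) (has_meanZ (-1) (cdf_has_mean mu t))).
rewrite mulN1r => H; apply: has_mean_le H m1E _ => x.
case: (leP x t) => xt /=; first by rewrite mulN1r subrr mulr0.
by rewrite mulr0 addr0 mulr1; apply: (le_trans (ltW xt)); exact: ler_norm.
Qed.

Lemma cdf_markov_left (m1 t : R) : has_mean mu (fun x => `|x|) m1 -> 0 < t ->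
  cdf mu (- t) <= m1 / t.
Proof.
move=> m1E t0; rewrite ler_pdivlMr// mulrC.
apply: has_mean_le (has_meanZ t (cdf_has_mean mu (- t))) m1E _ => x.
case: (leP x (- t)) => xt /=; last by rewrite mulr0.
by rewrite mulr1; have := ler_norm (- x); rewrite normrN; lra.
Qed.

Section quantile.
Variables (m1 : R) (m1E : has_mean mu (fun x => `|x|) m1).

(** The real [inf] is meaningful only for a nonempty set bounded below; Markov's inequality for |X|
    gives both, the two +1 keeping the test points nonzero. *)
Lemma cdf_inv_has_inf (p : R) : 0 < p < 1 -> has_inf [set x : R | p <= cdf mu x].
Proof.
move=> /andP[p0 p1].
have m10 : 0 <= m1 by apply: has_mean_le (has_mean_cst mu 0) m1E _ => x.
split.
  exists (m1 / (1 - p) + 1) => /=.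
  have t0 : 0 < m1 / (1 - p) + 1 by rewrite ltr_wpDl// divr_ge0//; lra.
  have := cdf_markov_right m1E t0.
  suff : m1 / (m1 / (1 - p) + 1) <= 1 - p by lra.
  rewrite ler_pdivrMr// mulrDr mulr1 mulrCA mulfV; last by rewrite gt_eqF//; lra.
  by rewrite mulr1; lra.
exists (- (m1 / p + 1)) => x /= px; rewrite leNgt; apply/negP => xl.
have t0 : 0 < m1 / p + 1 by rewrite ltr_wpDl// divr_ge0//; lra.
have := cdf_markov_left m1E t0.
have : m1 / (m1 / p + 1) < p.
  rewrite ltr_pdivrMr// mulrDr mulr1 mulrCA mulfV; last by rewrite gt_eqF//; lra.
  by rewrite mulr1; lra.
have := cdf_mono mu (ltW xl); lra.
Qed.

Lemma cdf_inv_right (p t : R) : 0 < p < 1 -> 0 < t -> p <= cdf mu (cdf_inv mu p + t).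
Proof.
move=> p01 t0; have [x /= px xt] := inf_adherent t0 (cdf_inv_has_inf p01).
by apply: (le_trans px); apply: cdf_mono; exact: ltW.
Qed.

Lemma cdf_inv_left (p t : R) : 0 < p < 1 -> 0 < t -> cdf mu (cdf_inv mu p - t) < p.
Proof.
move=> p01 t0; rewrite ltNge; apply/negP => H.
have [_ lb] := cdf_inv_has_inf p01.
have := ge_inf lb H; rewrite -/(cdf_inv mu p); lra.
Qed.

Lemma cdf_inv_mono (p r : R) : 0 < p < 1 -> 0 < r < 1 -> p <= r ->
  cdf_inv mu p <= cdf_inv mu r.
Proof.
move=> p01 r01 pr; rewrite leNgt; apply/negP => H.
have t0 : 0 < (cdf_inv mu p - cdf_inv mu r) / 2 by lra.
have := cdf_inv_right r01 t0; have := cdf_inv_left p01 t0.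
have -> : cdf_inv mu r + (cdf_inv mu p - cdf_inv mu r) / 2 =
   cdf_inv mu p - (cdf_inv mu p - cdf_inv mu r) / 2 by field.
lra.
Qed.

(** Continuity from above of mu along intervals shrinking to q. *)
Lemma cdf_no_atom (q eps : R) : mu [set q] = 0%E -> 0 < eps ->
  exists2 t : R, 0 < t & cdf mu (q + t) - cdf mu (q - t) < eps.
Proof.
move=> q0 e0; pose F (n : nat) : set R := [set` `]q - n.+1%:R^-1, q + n.+1%:R^-1]].
have i0 n : 0 < n.+1%:R^-1 :> R by rewrite invr_gt0.
have FE : \bigcap_n F n = [set q].
  apply/seteqP; split => x /=.
    move=> H; apply/eqP; rewrite -subr_eq0 -normr_eq0; apply: contraT => xq.
    have xq0 : 0 < `|x - q| by rewrite lt_neqAle eq_sym xq/=.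
    pose j := Num.truncn (`|x - q|^-1).
    have : j.+1%:R^-1 < `|x - q|.
      by rewrite -[ltRHS]invrK ltf_pV2 ?posrE ?invr_gt0//; exact: truncnS_gt.
    have := H j I; rewrite /F/= in_itv/= => /andP[h1 h2].
    by rewrite ltNge; have -> // : `|x - q| <= j.+1%:R^-1;
      move: h1 h2; move: (j.+1%:R^-1) => z h1 h2; apply/ler_normlP; split; lra.
  move=> -> n _; rewrite /F/= in_itv/=; have := i0 n.
  by move: (n.+1%:R^-1) => z h; apply/andP; split; lra.
have mF n : measurable (F n) by exact: measurable_itv.
have F0 : mu (\bigcap_n F n) = 0%E by rewrite FE.
have : (mu \o F) x @[x --> \oo] --> 0%E.
  rewrite -F0; apply: nonincreasing_cvg_mu => //.
  - by apply: (le_lt_trans (probability_le1 mu (mF 0%N))); exact: ltry.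
  - by rewrite FE.
  - move=> n m nm; apply/subsetPset => x; rewrite /F/= !in_itv/=.
    have : m.+1%:R^-1 <= n.+1%:R^-1 :> R by rewrite lef_pV2 ?posrE// ler_nat.
    move: (m.+1%:R^-1) (n.+1%:R^-1) => z w.
    by move=> h /andP[h1 h2]; apply/andP; split; lra.
have oe : (0 < eps%:E)%E by rewrite lte_fin.
move=> /(_ _ (open_ereal_lt' oe)).
case=> n _ /(_ n (leqnn n)) /=.
rewrite /F cdf_itv; last by have := i0 n; move: (n.+1%:R^-1) => z; lra.
by rewrite lte_fin => h; exists (n.+1%:R^-1).
Qed.

End quantile.

Section density.
Variables (I : interval R) (rho : R -> R).
Hypothesis mrho : measurable_fun setT rho.
Hypothesis muE : forall A, measurable A ->
  mu A = (\int[lebesgue_measure]_(x in A) (rho x)%:E)%E.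
Hypothesis muI : msupport mu = [set x | x \in I].
Hypothesis rhoI : forall x, interior [set y | y \in I] x -> 0 < rho x.
Hypothesis drho : forall x, x \in I ->
  cvg ((fun h => (rho (x + h) - rho x) / h) @
    within [set h | x + h \in I] (0 : R)^').
Variables (m1 : R) (m1E : has_mean mu (fun x => `|x|) m1).

Lemma mu_set1 q : mu [set q] = 0%E.
Proof. by rewrite muE//; exact: integral_set1. Qed.

(** If [I] had no point to the right of q, F would be 1 just after q and below p just before, a jump
    of more than 1 - p that [cdf_no_atom] excludes. The left side is symmetric, and [I] is an
    interval. *)
Lemma cdf_inv_nbhs (p : R) : 0 < p < 1 ->
  exists2 e : R, 0 < e & forall y, `|y - cdf_inv mu p| <= e -> y \in I.
Proof.
move=> p01; have /andP[p0 p1] := p01; set q := cdf_inv mu p.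
have suppC (A : set R) : measurable A -> (forall x, A x -> x \notin I) -> mu A = 0%E.
  move=> mA AI; apply: mu_disjoint_msupport => // x Ax.
  by rewrite muI /= => xI; move: (AI x Ax); rewrite xI.
have [b qb bI] : exists2 b, q < b & b \in I.
  apply: contrapT => H.
  have p1' : 0 < 1 - p by lra.
  have [t t0] := cdf_no_atom (mu_set1 q) p1'.
  have := cdf_inv_left m1E p01 t0; rewrite -/q.
  suff : cdf mu (q + t) = 1 by lra.
  have mq : measurable [set` `]q + t, +oo[] by exact: measurable_itv.
  have : mu [set` `]q + t, +oo[] = 0%E.
    apply: suppC => // x; rewrite /= in_itv/= andbT => qx; apply/negP => xI.
    by apply: H; exists x => //; lra.
  have -> : [set` `]q + t, +oo[] = ~` [set` `]-oo, q + t]] :> set R.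
    by apply/seteqP; split => x /=; rewrite !in_itv/= ?andbT ltNge => /negP.
  have mq' : measurable [set` `]-oo, q + t]] by exact: measurable_itv.
  rewrite probability_setC// -(@fineK _ (mu [set` `]-oo, q + t]])) ?fin_num_measure//.
  by rewrite -EFinB => -[]; rewrite -/(cdf mu (q + t)); lra.
have [a aq aI] : exists2 a, a < q & a \in I.
  apply: contrapT => H.
  have [t t0] := cdf_no_atom (mu_set1 q) p0.
  have := cdf_inv_right m1E p01 t0; rewrite -/q.
  suff : cdf mu (q - t) = 0 by lra.
  rewrite /cdf (suppC _ (measurable_itv _))// => x; rewrite /= in_itv/= => qx; apply/negP => xI.
  by apply: H; exists x => //; lra.
exists (Num.min (b - q) (q - a)); first by rewrite lt_min; apply/andP; split; lra.
move=> y; rewrite le_min => /andP[/ler_normlP[_ y1] /ler_normlP[y2 _]].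
apply: (interval_is_interval aI bI); apply/andP; split; lra.
Qed.

Lemma density_lower_bound (p : R) : 0 < p < 1 ->
  exists c e : R, [/\ 0 < c, 0 < e &
    forall y, `|y - cdf_inv mu p| <= e -> c <= rho y].
Proof.
move=> p01; set q := cdf_inv mu p; have [e e0 eI] := cdf_inv_nbhs p01.
rewrite -/q in eI.
have qI : q \in I by apply: eI; rewrite subrr normr0 ltW.
have rq : 0 < rho q.
  apply: rhoI; apply/nbhs_ballP; exists e => //= y; rewrite -ball_normE/= => qy.
  by apply: eI; rewrite distrC ltW.
have /cvg_ex[l] := drho qI.
move=> /(@cvgrPdist_le _ R^o) /(_ 1 ltr01).
rewrite !near_withinE => /nbhs_ballP[d /= d0 H].
pose L := `|l| + 1; have L0 : 0 < L by rewrite ltr_wpDl.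
(* Within e' the point stays in [I], the difference quotient is within 1 of its limit and so at most
   L, and rho loses at most half of its value at q. *)
pose e' := Num.min (e / 2) (Num.min (d / 2) (rho q / (2 * L))).
have e'0 : 0 < e' by rewrite !lt_min !divr_gt0// mulr_gt0.
exists (rho q / 2), e'; split; [by rewrite divr_gt0|by []|] => y.
rewrite !le_min => /and3P[y1 y2 y3].
have [->|yq] := eqVneq y q; first lra.
have h0 : y - q != 0 by rewrite subr_eq0.
have := H (y - q); rewrite -ball_normE/= sub0r normrN => /(_ ltac:(lra) h0).
rewrite addrC subrK => /(_ (eI y ltac:(lra))) H1.
have : `|(rho y - rho q) / (y - q)| <= L.
  have := ler_distD l 0 ((rho y - rho q) / (y - q)); rewrite !sub0r !normrN /L; lra.
rewrite normrM normfV ler_pdivrMr ?normr_gt0// => H2.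
have : L * `|y - q| <= rho q / 2.
  by move: y3; rewrite invfM mulrA ler_pdivlMr// mulrC.
have := ler_norm (rho q - rho y); rewrite distrC; lra.
Qed.

Lemma cdf_increment (q c e a b : R) : 0 < c ->
  (forall y, `|y - q| <= e -> c <= rho y) ->
  q - e <= a -> a <= b -> b <= q + e -> c * (b - a) <= cdf mu b - cdf mu a.
Proof.
move=> c0 rc qa ab bq; rewrite -lee_fin -cdf_itv//.
have mab : measurable [set` `]a, b]] by exact: measurable_itv.
rewrite muE//.
have -> : (c * (b - a))%:E = (\int[lebesgue_measure]_(x in [set` `]a, b]]) (cst c%:E) x)%E.
  rewrite integral_cst//= lebesgue_measure_itv/= lte_fin.
  case: ltP => [_|ba]; first by rewrite -EFinB -EFinM.
  have -> : a = b by lra.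
  by rewrite subrr mulr0 mule0.
apply: ge0_le_integral => //.
- by move=> x _; rewrite lee_fin ltW.
- apply/measurable_EFinP; exact: measurable_funTS.
- move=> x /=; rewrite in_itv/= => /andP[ax xb]; rewrite lee_fin; apply: rc.
  by apply/ler_normlP; split; lra.
Qed.

Lemma cdf_inv_growth (p : R) : 0 < p < 1 ->
  exists c e : R, [/\ 0 < c, 0 < e,
    forall a b, cdf_inv mu p - e <= a -> a <= b -> b <= cdf_inv mu p + e ->
      c * (b - a) <= cdf mu b - cdf mu a,
    forall t : R, 0 < t <= e -> p + c * t <= cdf mu (cdf_inv mu p + t) &
    forall t : R, 0 < t <= e -> cdf mu (cdf_inv mu p - t) <= p - c * t].
Proof.
move=> p01; have [c [e [c0 e0 rc]]] := density_lower_bound p01.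
set q := cdf_inv mu p in rc *.
have inc a b := @cdf_increment q c e a b c0 rc.
(* [cdf_inv_right] and [cdf_inv_left] only give bounds at q + s and q - s for s > 0; this lets s
   tend to 0. *)
have eps (x y : R) (t : R) : 0 < t ->
    (forall s : R, 0 < s < t -> x - c * s <= y) -> x <= y.
  move=> t0 H; rewrite leNgt; apply/negP => yx.
  pose s := Num.min (t / 2) ((x - y) / (2 * c)).
  have s0 : 0 < s by rewrite lt_min !divr_gt0 ?mulr_gt0//; lra.
  have [s1 s2] : s <= t / 2 /\ s <= (x - y) / (2 * c).
    by split; rewrite ge_min lexx ?orbT.
  have := H s ltac:(by apply/andP; split; lra).
  move: s2; rewrite ler_pdivlMr ?mulr_gt0//; lra.
exists c, e; split => // t /andP[t0 te].
  apply: (eps _ _ t t0) => s /andP[s0 st].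
  have := cdf_inv_right m1E p01 s0; rewrite -/q.
  by have := @inc (q + s) (q + t) ltac:(lra) ltac:(lra) ltac:(lra); lra.
rewrite -lerN2; apply: (eps _ _ t t0) => s /andP[s0 st].
have := cdf_inv_left m1E p01 s0; rewrite -/q.
by have := @inc (q - t) (q - s) ltac:(lra) ltac:(lra) ltac:(lra); lra.
Qed.

End density.

Lemma mindist_mean_lower (q c e : R) (k : nat) : 0 < c -> 0 < e -> (0 < k)%N ->
  (forall a b, q - e <= a -> a <= b -> b <= q + e ->
      c * (b - a) <= cdf mu b - cdf mu a) ->
  exists2 b : R, 0 < b & forall ys m, size ys = k -> has_mean mu (mindist ys) m -> b <= m.
Proof.
move=> c0 e0 k0 inc; pose eta := e / k.+1%:R.
have kR : 0 < k.+1%:R :> R by [].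
have eta0 : 0 < eta by rewrite divr_gt0.
(* Of k + 1 disjoint intervals of length eta near q, one contains no point of ys;
   its middle third has mass at least c eta / 3 and is eta / 3 away from ys. *)
exists (eta / 3 * (c * (eta / 3))); first by rewrite !mulr_gt0 ?divr_gt0.
move=> ys m ysk mE.
have [i Hi] : exists i : 'I_k.+1, forall y, y \in ys ->
    ~~ (q + i%:R * eta < y < q + i.+1%:R * eta).
  apply: contrapT => H.
  have {}H (i : 'I_k.+1) : exists j : 'I_k,
      q + i%:R * eta < nth 0 ys j < q + i.+1%:R * eta.
    apply: contrapT => Hj; apply: H; exists i => y /(nthP 0)[j jk <-].
    by rewrite ysk in jk; apply/negP => Hy; apply: Hj; exists (Ordinal jk).
  have [f Hf] := choice H.
  have : injective f.
    move=> i1 i2 fE; apply: val_inj => /=.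
    have := Hf i1; have := Hf i2; rewrite fE => /andP[h1 h2] /andP[h3 h4].
    have aux (m1 m2 : nat) (y : R) : q + m1%:R * eta < y -> y < q + m2.+1%:R * eta -> (m1 <= m2)%N.
      move=> a1 a2; have : m1%:R * eta < m2.+1%:R * eta by lra.
      by rewrite ltr_pM2r// ltr_nat.
    by apply/eqP; rewrite eqn_leq (aux _ _ _ h3 h2) (aux _ _ _ h1 h4).
  by move=> /leq_card; rewrite !card_ord ltnn.
pose a := q + i%:R * eta + eta / 3; pose b := q + i%:R * eta + 2 * eta / 3.
have ie0 : 0 <= i%:R * eta by rewrite mulr_ge0// ltW.
have ie : i.+1%:R * eta <= e.
  have -> : e = k.+1%:R * eta by rewrite /eta mulrC divfK// gt_eqF.
  by rewrite ler_wpM2r ?(ltW eta0)// ler_nat.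
have iS : i.+1%:R * eta = i%:R * eta + eta by rewrite -natr1 mulrDl mul1r.
have := @inc a b ltac:(rewrite /a; lra) ltac:(rewrite /a /b; lra) ltac:(rewrite /b; lra).
have -> : b - a = eta / 3 by rewrite /a /b; field.
move=> ab; apply: (@le_trans _ _ (eta / 3 * (cdf mu b - cdf mu a))).
  by rewrite ler_wpM2l// divr_ge0// ltW.
have := has_meanZ (eta / 3) (has_meanD (cdf_has_mean mu b) (has_meanZ (-1) (cdf_has_mean mu a))).
rewrite mulN1r => H; apply: has_mean_le H mE _ => x.
have [xa|xa] := leP x a.
  have -> : x <= b by apply: (le_trans xa); rewrite /a /b; lra.
  by rewrite mulN1r subrr mulr0 mindist_ge0.
have [xb|xb] := leP x b; last by rewrite mulr0 addr0 mulr0 mindist_ge0.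
rewrite mulr0 addr0 mulr1.
have [y yys ->] := @mindist_attained R ys x ltac:(by rewrite ysk).
have := Hi y yys; rewrite negb_and -!leNgt => /orP[h|h].
  by rewrite ger0_norm; rewrite /a /b in xa xb; lra.
by rewrite distrC ger0_norm; rewrite /a /b in xa xb; lra.
Qed.

(** Brings both alternatives to the weight used in [cdf_tail]. A compact support makes the weight
    almost surely bounded, so delta = 1 will do; otherwise (1 + |x|)^a <= 2^a (1 + |x|^a). *)
Lemma moments (I : interval R) : msupport mu = [set x | x \in I] ->
  (compact [set x | x \in I] \/
   exists delta : R, 0 < delta /\
     (\int[mu]_x ((`|x|) `^ (2 + delta))%:E < +oo)%E) ->
  exists delta K m2 : R, [/\ 0 < delta,
    has_mean mu (fun x => (1 + `|x|) `^ (2 + delta)) K &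
    has_mean mu (fun x => x ^+ 2) m2].
Proof.
move=> muI H.
have mabs : measurable_fun setT (fun x : R => `|x|) by exact: normr_measurable.
have mpow a : measurable_fun setT (fun x : R => (1 + `|x|) `^ a).
  apply: (measurableT_comp (measurable_powR a)).
  exact: measurable_funD.
suff [delta d0 intd] : exists2 delta : R, 0 < delta &
    mu.-integrable setT (EFin \o (fun x => (1 + `|x|) `^ (2 + delta))).
  have int2 : mu.-integrable setT (EFin \o (fun x : R => x ^+ 2)).
    apply: le_integrable intd => //.
      by apply/measurable_EFinP; exact: measurable_funX.
    move=> x _ /=; rewrite lee_fin [leLHS]ger0_norm ?sqr_ge0// [leRHS]ger0_norm ?powR_ge0//.
    apply: (@le_trans _ _ ((1 + `|x|) `^ 2)).
      rewrite powR_mulrn ?addr_ge0// -real_normK ?num_real//.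
      by rewrite lerXn2r ?nnegrE ?addr_ge0// lerDr.
    have x1 : 1 <= 1 + `|x| by rewrite lerDl.
    by apply: (ler_powR x1); rewrite lerDl ltW.
  by exists delta; do 2 eexists; split; [exact: d0|exact: has_mean_Rintegral intd|
    exact: has_mean_Rintegral int2].
case: H => [cI|[delta [d0 H]]].
  exists 1 => //.
  have [L LI] : exists L : R, forall x, x \in I -> `|x| <= L.
    have /= := compact_bounded cI; rewrite /bounded_near => -[L [_ HL]].
    by exists (L + 1) => x xI; apply: (HL (L + 1) _ x xI); rewrite ltrDl.
  apply/integrableP; split; first exact/measurable_EFinP.
  apply: (@le_lt_trans _ _ (\int[mu]_x (cst ((1 + `|L|) `^ (2 + 1))%:E) x)%E).
    apply: ae_ge0_le_integral => //.
    - by apply: measurableT_comp => //; exact/measurable_EFinP.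
    - by move=> x _; rewrite lee_fin powR_ge0.
    - apply: (@negligibleS _ _ _ _ (~` msupport mu)); last exact: msupportC_negligible.
      move=> x /= Hx; rewrite muI /= => xI; apply: Hx => _.
      rewrite lee_fin ger0_norm ?powR_ge0// ge0_ler_powR ?nnegrE ?addr_ge0//.
      by rewrite lerD2l (le_trans (LI x xI))// ler_norm.
  rewrite integral_cst//.
  apply: (@le_lt_trans _ _ ((1 + `|L|) `^ (2 + 1))%:E); last exact: ltry.
  rewrite -[leRHS]mule1 lee_wpmul2l ?lee_fin ?powR_ge0//.
  exact: probability_le1.
exists delta => //; set a := 2 + delta in H *.
have a0 : 0 <= a by rewrite addr_ge0// ltW.
have intp : mu.-integrable setT (EFin \o (fun x : R => `|x| `^ a)).
  apply/integrableP; split.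
    by apply/measurable_EFinP; exact: (measurableT_comp (measurable_powR a)).
  by under eq_integral do rewrite /= ger0_norm ?powR_ge0//.
have [intg _] := has_meanZ (2 `^ a) (has_meanD (has_mean_cst mu 1) (has_mean_Rintegral intp)).
apply: le_integrable intg => //; first exact/measurable_EFinP.
move=> x _ /=; rewrite lee_fin [leLHS]ger0_norm ?powR_ge0//.
rewrite [leRHS]ger0_norm ?mulr_ge0 ?addr_ge0 ?powR_ge0//.
have [x1|x1] := leP `|x| 1.
  apply: (@le_trans _ _ (2 `^ a)).
    by rewrite ge0_ler_powR ?nnegrE ?addr_ge0//; lra.
  by rewrite ler_peMr ?powR_ge0// lerDl powR_ge0.
apply: (@le_trans _ _ ((2 * `|x|) `^ a)).
  by rewrite ge0_ler_powR ?nnegrE ?addr_ge0 ?mulr_ge0//; lra.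
by rewrite powRM// ler_wpM2l ?powR_ge0// lerDr.
Qed.

End MeasureFacts.

(** * Wasserstein distance from mu to finitely supported measures *)

Section Wasserstein.
Context {R : realType} (mu : probability R R).
Implicit Types (ys : seq R).

Let mid ys (i : nat) : R := (nth 0 ys i.-1 + nth 0 ys i) / 2.

(** For sorted [ys], the index of a nearest point among the first K + 1, found by scanning midpoints
    from the right. A tie goes to the left point, in accordance with the closed half-line in
    [cdf]. *)
Fixpoint cell_index ys (K : nat) (x : R) : nat :=
  if K is K'.+1 then (if x <= mid ys K then cell_index ys K' x else K) else 0.

Section fixed_ys.
Variables (ys : seq R) (ys_sorted : sorted <=%R ys).

Let ysle (i j : nat) : (i <= j)%N -> (j < size ys)%N -> nth 0 ys i <= nth 0 ys j.
Proof.
move=> ij js; apply: (sorted_leq_nth le_trans lexx) => //.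
by rewrite inE (leq_ltn_trans ij).
Qed.

Lemma cell_index_le (K : nat) (x : R) : (cell_index ys K x <= K)%N.
Proof.
elim: K => [//|K IH] /=; case: ifP => _ //; exact: leq_trans IH (leqnSn K).
Qed.

Lemma cell_index_max (K : nat) (x : R) : (K < size ys)%N ->
  mid ys K.+1 < x -> (K.+1 < size ys)%N -> cell_index ys K x = K.
Proof.
case: K => [//|K] Ks xm KS /=; rewrite leNgt.
suff -> : mid ys K.+1 < x by [].
apply: le_lt_trans xm; rewrite /mid ler_wpM2r// lerD// ysle//.
Qed.

(** A function of the cell is a sum of jumps at midpoints, so its mean can be read off the c.d.f.
    The general [g] covers both the nearest-point map itself, for measurability, and indicators, for
    its law. *)
Lemma cell_index_step (g : nat -> R) (K : nat) (x : R) : (K < size ys)%N ->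
  g (cell_index ys K x) = g 0%N +
    \sum_(i < K) (g i.+1 - g i) * (1 - (x <= mid ys i.+1)%R%:R).
Proof.
elim: K => [|K IH] Ks; first by rewrite big_ord0 addr0.
rewrite big_ord_recr/= addrA -IH; last exact: ltnW.
case: leP => xm; first by rewrite subrr mulr0 addr0.
by rewrite subr0 mulr1 cell_index_max ?subrKC// ltnW.
Qed.

Lemma cell_index_has_mean (g : nat -> R) (K : nat) : (K < size ys)%N ->
  has_mean mu (fun x => g (cell_index ys K x))
   (g 0%N + \sum_(i < K) (g i.+1 - g i) * (1 - cdf mu (mid ys i.+1))).
Proof.
move=> Ks; rewrite (_ : (fun x => _) = fun x => g 0%N +
    \sum_(i < K) (g i.+1 - g i) * (1 - (x <= mid ys i.+1)%R%:R)); last first.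
  by apply/funext => x; exact: cell_index_step.
apply: has_meanD; first exact: has_mean_cst.
elim: K {Ks} => [|K IH].
  rewrite big_ord0; have := has_mean_cst mu 0.
  by congr has_mean; apply/funext => x; rewrite big_ord0.
rewrite big_ord_recr/=; under eq_fun do rewrite big_ord_recr/=.
apply: has_meanD => //; apply: has_meanZ.
apply: has_meanD; first exact: has_mean_cst.
have := has_meanZ (-1) (cdf_has_mean mu (mid ys K.+1)).
by rewrite mulN1r; congr has_mean; apply/funext => x; rewrite mulN1r.
Qed.

Lemma cell_index_upper (K m : nat) (x : R) :
  (cell_index ys K x < m <= K)%N -> x <= mid ys m.
Proof.
elim: K => [|K IH] /=; first by case: m.
case: leP => xm /andP[im mK]; last by move: im; rewrite ltnNge mK.
move: mK; rewrite leq_eqVlt => /orP[/eqP->//|mK].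
by apply: IH; rewrite im.
Qed.

Lemma cell_index_lower (K : nat) (x : R) : (0 < cell_index ys K x)%N ->
  mid ys (cell_index ys K x) < x.
Proof.
elim: K => [//|K IH] /=; case: ifPn => [_|]; first exact: IH.
by rewrite -ltNge.
Qed.

Lemma cell_index_mindist (x : R) : (0 < size ys)%N ->
  mindist ys x = `|x - nth 0 ys (cell_index ys (size ys).-1 x)|.
Proof.
move=> s0; set i := cell_index _ _ _.
have isz : (i < size ys)%N.
  by rewrite -[X in (_ < X)%N](prednK s0) ltnS cell_index_le.
apply/le_anti/andP; split; first by apply: mindist_le; rewrite mem_nth.
have [y /(nthP 0)[j js <-] ->] := mindist_attained x s0.
have [ij|ji|<-//] := ltngtP i j.
  have iS : (i.+1 < size ys)%N by rewrite (leq_ltn_trans ij).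
  have : x <= mid ys i.+1.
    by apply: (@cell_index_upper (size ys).-1); rewrite ltnSn/= -ltnS (prednK s0).
  rewrite /mid/= => xm; have y1 := ysle (leqnSn i) iS; have y2 := ysle ij js.
  have [xi|xi] := leP (nth 0 ys i) x.
    by rewrite ger0_norm ?subr_ge0//; have := ler_norm (nth 0 ys j - x); rewrite distrC; lra.
  by rewrite ltr0_norm ?subr_lt0//; have := ler_norm (nth 0 ys j - x); rewrite distrC; lra.
have i0 : (0 < i)%N by rewrite (leq_ltn_trans _ ji).
have := cell_index_lower i0; rewrite -/i /mid => xm.
have y1 : nth 0 ys j <= nth 0 ys i.-1.
  by apply: ysle; [rewrite -ltnS (prednK i0)|rewrite (leq_ltn_trans (leq_pred i))].
have y2 : nth 0 ys i.-1 <= nth 0 ys i by apply: ysle => //; exact: leq_pred.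
have [xi|xi] := leP (nth 0 ys i) x.
  by rewrite ger0_norm ?subr_ge0//; have := ler_norm (x - nth 0 ys j); lra.
by rewrite ltr0_norm ?subr_lt0//; have := ler_norm (x - nth 0 ys j); lra.
Qed.

End fixed_ys.

Definition voronoi_cdf ys (i : nat) : R :=
  if i == 0%N then 0 else if i == size ys then 1 else cdf mu (mid ys i).

(** For sorted nonempty [ys], the law under mu of the nearest point of [ys]; [nuQ] is the case of
    quantiles. *)
Definition voronoi ys : set R -> \bar R := fun A =>
  (\sum_(j < size ys) (voronoi_cdf ys j.+1 - voronoi_cdf ys j)%:E *
     \d_((nth 0 ys j)%R) A)%E.

Lemma abel_sum (G a : nat -> R) (K : nat) :
  \sum_(j < K.+1) (G j.+1 - G j) * a j =
  G K.+1 * a K - G 0%N * a 0%N - \sum_(i < K) G i.+1 * (a i.+1 - a i).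
Proof.
elim: K => [|K IH]; first by rewrite big_ord_recl !big_ord0; ring.
by rewrite big_ord_recr/= IH [in RHS]big_ord_recr/=; ring.
Qed.

(** Summation by parts, from cell weights to the jump form of [cell_index_has_mean]. *)
Lemma voronoi_mean ys (a : nat -> R) : (0 < size ys)%N ->
  \sum_(j < size ys) (voronoi_cdf ys j.+1 - voronoi_cdf ys j) * a j =
  a 0%N + \sum_(i < (size ys).-1) (a i.+1 - a i) * (1 - cdf mu (mid ys i.+1)).
Proof.
move=> s0; have [K KE] : exists K, size ys = K.+1 by exists (size ys).-1; rewrite prednK.
rewrite KE/= abel_sum /voronoi_cdf eqxx KE eqxx/= mul1r mul0r subr0.
have -> : \sum_(i < K) (a i.+1 - a i) * (1 - cdf mu (mid ys i.+1)) =
   \sum_(i < K) (a i.+1 - a i) - \sum_(i < K) (a i.+1 - a i) * cdf mu (mid ys i.+1).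
  by rewrite -sumrB; apply: eq_bigr => i _; ring.
have -> : \sum_(i < K) (a i.+1 - a i) = a K - a 0%N.
  elim: (K) => [|K' IH]; first by rewrite big_ord0 subrr.
  by rewrite big_ord_recr/= IH; ring.
have -> : \sum_(i < K) (if i.+1 == K.+1 then 1 else cdf mu (mid ys i.+1)) * (a i.+1 - a i) =
   \sum_(i < K) (a i.+1 - a i) * cdf mu (mid ys i.+1).
  by apply: eq_bigr => i _; rewrite eqSS ltn_eqF// mulrC.
ring.
Qed.

Lemma measurable_dist :
  measurable_fun [set: R * R] (fun z : R * R => (`|z.1 - z.2|)%:E).
Proof.
apply/measurable_EFinP; apply: measurableT_comp => //.
by apply: measurable_funB; [exact: measurable_fst|exact: measurable_snd].
Qed.

Lemma measurable_seq ys : measurable ([set` ys] : set R).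
Proof.
elim: ys => [|y ys IH]; first by rewrite set_nil.
rewrite (_ : [set` y :: ys] = [set y] `|` [set` ys]); first exact: measurableU.
apply/seteqP; split => x /=; rewrite inE.
  by move=> /orP[/eqP|]; [left|right].
by case=> [->|->]; rewrite ?eqxx ?orbT.
Qed.

(** The coupling is the law of (x, T x) with T the nearest-point map; its cost is exactly the mean
    of [mindist ys]. *)
Lemma voronoi_coupling ys m : sorted <=%R ys -> (0 < size ys)%N ->
  has_mean mu (mindist ys) m -> (W1 mu (voronoi ys) <= m%:E)%E.
Proof.
move=> sys s0 mE; set K := (size ys).-1.
have Ks : (K < size ys)%N by rewrite /K prednK.
pose T x : R := nth 0 ys (cell_index ys K x).
have Tm g := cell_index_has_mean sys g Ks.
have mT : measurable_fun setT T.
  by have [/integrableP[/measurable_EFinP]] := Tm (nth 0 ys).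
have mX : measurable_fun setT (fun x : R => (x, T x)).
  exact: measurable_fun_pair.
pose X : {mfun R >-> (R * R)%type} := mfun_Sub (mem_set mX).
pose pi : probability (R * R)%type R := distribution mu X.
have XE x : X x = (x, T x) by [].
rewrite -(has_mean_integral mE); apply: ereal_inf_lbound; exists pi.
  move=> A mA; split.
    rewrite /pi/= /distribution/= /pushforward; congr (mu _).
    by apply/seteqP; split => x /=; [case|].
  rewrite /pi/= /distribution/= /pushforward.
  have -> : X @^-1` (setT `*` A) = T @^-1` A.
    by apply/seteqP; split => x /=; [case|].
  have mTA : measurable (T @^-1` A) by rewrite -[X in measurable X]setTI; exact: mT.
  (* The second marginal of A is the mean of the indicator of A composed with T, a function of the
     cell index. *)
  have := has_mean_integral (Tm (fun j => \1_A (nth 0 ys j))).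
  have -> : (\int[mu]_x (\1_A (nth 0 ys (cell_index ys K x)))%:E = mu (T @^-1` A))%E.
    by rewrite -[X in mu X]setIT -integral_indic//; apply: eq_integral => x _.
  move=> ->; transitivity (\sum_(j < size ys)
      (voronoi_cdf ys j.+1 - voronoi_cdf ys j) * \1_A (nth 0 ys j))%:E.
    congr EFin; symmetry.
    exact: (@voronoi_mean ys (fun j => \1_A (nth 0 ys j)) s0).
  rewrite /voronoi -sumEFin; apply: eq_bigr => j _.
  by rewrite EFinM diracE indicE.
rewrite ge0_integral_pushforward//=; last exact: measurable_dist.
rewrite preimage_setT.
by apply: eq_integral => x _ /=; rewrite -cell_index_mindist.
Qed.

(* The second marginal charges only ys, so almost surely |z1 - z2| is at least
   the distance from z1 to ys. *)
Lemma W1_ge (lam : set R -> \bar R) ys m : (0 < size ys)%N ->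
  lam (~` [set` ys]) = 0%E -> has_mean mu (mindist ys) m -> (m%:E <= W1 mu lam)%E.
Proof.
move=> s0 lam0 mE; apply: le_ereal_inf_tmp => _ [pi cpi <-].
have mys := measurable_seq ys.
rewrite -(has_mean_integral mE).
have mmd : measurable_fun setT (EFin \o mindist ys) by case: mE => /integrableP[].
have -> : (\int[mu]_x (mindist ys x)%:E = \int[pi]_z (mindist ys z.1)%:E)%E.
  transitivity (\int[pushforward pi (@fst R R)]_x (mindist ys x)%:E)%E.
    apply: eq_measure_integral => A mA _ /=; rewrite /pushforward.
    have [<- _] := cpi A mA; congr (pi _).
    by apply/seteqP; split => z /=; [case|].
  rewrite ge0_integral_pushforward//= => x _.
  by rewrite lee_fin mindist_ge0.
apply: ae_ge0_le_integral => //.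
- by move=> z _; rewrite lee_fin mindist_ge0.
- exact: (measurableT_comp mmd measurable_fst).
- exact: measurable_dist.
exists (setT `*` ~` [set` ys]); split.
- by apply: measurableX => //; exact: measurableC.
- have [_] := cpi _ (measurableC mys); rewrite lam0 => H; exact: H.
- move=> z /= Hz; split => // zys; apply: Hz => _.
  by rewrite lee_fin; exact: mindist_le.
Qed.

Lemma voronoi_supp ys : voronoi ys (~` [set` ys]) = 0%E.
Proof.
rewrite /voronoi big1// => j _; rewrite diracE.
by rewrite memNset ?mule0//= => /(_ _); apply; rewrite mem_nth.
Qed.

Lemma W1_voronoi ys m : sorted <=%R ys -> (0 < size ys)%N ->
  has_mean mu (mindist ys) m -> W1 mu (voronoi ys) = m%:E.
Proof.
move=> sys s0 mE; apply/eqP; rewrite eq_le voronoi_coupling//=.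
by apply: (W1_ge s0) => //; exact: voronoi_supp.
Qed.

Lemma nuQ_voronoi (v : seq R) : nuQ mu v = voronoi (map (cdf_inv mu) v).
Proof.
apply/funext => A; rewrite /nuQ /voronoi size_map; apply: eq_bigr => j _.
have Fz i : (i <= size v)%N -> nuQ_Fz mu v i = voronoi_cdf (map (cdf_inv mu) v) i.
  rewrite /nuQ_Fz /voronoi_cdf size_map => iv; case: eqP => // i0; case: eqP => // iv'.
  have iv2 : (i < size v)%N by rewrite ltn_neqAle iv andbT; apply/eqP.
  by rewrite /mid /nuQ_atom !(nth_map 0)// (leq_ltn_trans (leq_pred i)).
by rewrite !Fz// ?(ltnW (ltn_ord j))// /nuQ_atom (nth_map 0).
Qed.

Lemma voronoi_Pk ys : sorted <=%R ys -> (0 < size ys)%N -> Pk (size ys) (voronoi ys).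
Proof.
move=> sys s0.
exists (fun j : 'I_(size ys) => voronoi_cdf ys j.+1 - voronoi_cdf ys j).
exists (fun j : 'I_(size ys) => nth 0 ys j); split; [|split] => //.
  move=> j; rewrite subr_ge0 /voronoi_cdf /=.
  have := ltn_ord j; rewrite leq_eqVlt => /orP[/eqP->|jS].
    rewrite eqxx; case: ifP => // _; case: ifP => // _; exact: cdf_le1.
  rewrite (ltn_eqF jS); case: eqP => [_|j0]; first exact: cdf_ge0.
  rewrite (ltn_eqF (ltn_ord j)); apply: cdf_mono.
  have sle i l : (i <= l)%N -> (l < size ys)%N -> nth 0 ys i <= nth 0 ys l.
    move=> il ls; apply: (sorted_leq_nth le_trans lexx) => //.
    by rewrite inE (leq_ltn_trans il).
  by rewrite /mid ler_wpM2r// lerD// sle// ?leq_pred// ltn_ord.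
have := voronoi_mean (fun=> 1) s0.
rewrite [X in _ = 1 + X]big1 ?addr0; last by move=> i _; rewrite subrr mul0r.
by move=> <-; apply: eq_bigr => j _; rewrite mulr1.
Qed.

Hypothesis mom1 : mu.-integrable setT (EFin \o (fun x : R => `|x|)).

Lemma mindist_has_mean ys : (0 < size ys)%N ->
  has_mean mu (mindist ys) (\int[mu]_x mindist ys x).
Proof.
move=> s0; apply: has_mean_Rintegral.
exact: (lipschitz1_integrable mom1 ler01 (mindist_lipschitz s0)).
Qed.

(** A configuration, once sorted, carries a Voronoi measure in [Pk] that realises its cost;
    conversely a measure in [Pk] is at least as far from mu as the cost of its list of atoms, by
    [W1_ge]. *)
Lemma W1_k_inf (k : nat) : (0 < k)%N ->
  exists B : R, [/\ W1_k mu k = B%:E,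
    forall ys, size ys = k -> B <= \int[mu]_x mindist ys x &
    forall b, (forall ys, size ys = k -> b <= \int[mu]_x mindist ys x) -> b <= B].
Proof.
move=> k0.
have ub ys : size ys = k -> (W1_k mu k <= (\int[mu]_x mindist ys x)%:E)%E.
  move=> ysk; pose zs := sort <=%R ys.
  have zsk : size zs = k by rewrite size_sort.
  have szs : sorted <=%R zs by apply: sort_sorted; exact: le_total.
  have mE : mindist ys = mindist zs.
    apply/funext => x; apply: mindist_perm; rewrite ?ysk ?zsk// => y.
    by rewrite mem_sort.
  have zs0 : (0 < size zs)%N by rewrite zsk.
  rewrite mE -(W1_voronoi szs zs0 (mindist_has_mean zs0)).
  apply: ereal_inf_lbound; exists (voronoi zs) => //.
  by have := voronoi_Pk szs zs0; rewrite zsk.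
have lb (b : R) : (forall ys, size ys = k -> b <= \int[mu]_x mindist ys x) ->
    (b%:E <= W1_k mu k)%E.
  move=> H; apply: le_ereal_inf_tmp => _ [_ [w [x [_ [_ ->]]]] <-].
  pose ys := [seq x j | j <- enum 'I_k].
  have ysk : size ys = k by rewrite size_map size_enum_ord.
  have ys0 : (0 < size ys)%N by rewrite ysk.
  apply: (@le_trans _ _ (\int[mu]_x mindist ys x)%:E); first by rewrite lee_fin H.
  apply: (W1_ge ys0 _ (mindist_has_mean ys0)).
  rewrite big1// => j _; rewrite diracE memNset ?mule0//= => /(_ _); apply.
  by apply: map_f; rewrite mem_enum.
have fin : W1_k mu k \is a fin_num.
  rewrite fin_numElt; apply/andP; split.
    apply: (@lt_le_trans _ _ 0%E) => //; apply: lb => ys ysk.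
    by apply: Rintegral_ge0 => x _; exact: mindist_ge0.
  by apply: (le_lt_trans (ub (nseq k 0) _)); rewrite ?size_nseq// ltry.
exists (fine (W1_k mu k)); rewrite fineK//; split => //.
  by move=> ys ysk; rewrite -lee_fin fineK// ub.
by move=> b bH; rewrite -lee_fin fineK// lb.
Qed.

End Wasserstein.

(** * From rates for the two expectations to the rate for their ratio *)

Section Rates.
Context {R : realType}.

Lemma ratio_rate (A B C1 C2 N1 : R) (An Bn : nat -> R) : 0 < B -> 0 <= A ->
  (forall n : nat, (0 < n)%N -> N1 <= n%:R -> `|An n - A| <= C1 / Num.sqrt n%:R) ->
  (forall n : nat, (0 < n)%N -> `|Bn n - B| <= C2 / Num.sqrt n%:R) ->
  exists C N : R, forall n : nat, N <= n%:R ->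
    `|An n / Bn n - A / B| <= C / Num.sqrt n%:R.
Proof.
move=> B0 A0 HA HB.
(* The threshold forces C2 n^(-1/2) <= B / 2, hence Bn n >= B / 2; this is the origin of the factor
   2. *)
exists (2 * (C1 * B + A * C2) / B ^+ 2), (Num.max N1 (1 + (2 * C2 / B) ^+ 2)) => n.
rewrite ge_max => /andP[N1n nn].
have sq0 : 0 <= (2 * C2 / B) ^+ 2 by rewrite sqr_ge0.
have nR : 0 < n%:R :> R by lra.
have n0 : (0 < n)%N by rewrite -(ltr0n R).
have sn : 0 < Num.sqrt n%:R :> R by rewrite sqrtr_gt0.
have := HA n n0 N1n; have := HB n n0; set r := (Num.sqrt n%:R)^-1.
have r0 : 0 < r by rewrite invr_gt0.
have C2r : C2 * r <= B / 2.
  rewrite /r ler_pdivrMr//.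
  have : 2 * C2 / B <= Num.sqrt n%:R.
    apply: (le_trans (ler_norm _)); rewrite -sqrtr_sqr; apply: ler_wsqrtr; lra.
  by rewrite ler_pdivrMr//; lra.
move=> HBn HAn.
have Bn2 : B / 2 <= Bn n by move: HBn => /ler_normlP[]; lra.
have Bn0 : 0 < Bn n by lra.
have -> : An n / Bn n - A / B = ((An n - A) * B + A * (B - Bn n)) / (Bn n * B).
  by field; rewrite !gt_eqF.
rewrite normrM normfV (gtr0_norm (mulr_gt0 Bn0 B0)) ler_pdivrMr ?mulr_gt0//.
have num : `|(An n - A) * B + A * (B - Bn n)| <= (C1 * B + A * C2) * r.
  apply: (le_trans (ler_normD _ _)); rewrite !normrM (gtr0_norm B0) (ger0_norm A0).
  have : `|An n - A| * B <= C1 * r * B by rewrite ler_wpM2r// ltW.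
  have : A * `|B - Bn n| <= A * (C2 * r) by rewrite ler_wpM2l// distrC.
  lra.
apply: (le_trans num).
have D0 : 0 <= (C1 * B + A * C2) * r by exact: le_trans num.
have -> : 2 * (C1 * B + A * C2) / B ^+ 2 * r * (Bn n * B) =
   (C1 * B + A * C2) * r * (2 * Bn n / B) by field; rewrite gt_eqF.
by rewrite ler_peMr// ler_pdivlMr//; lra.
Qed.

(* The finitely many n < N are absorbed in the constant. *)
Lemma rate_all_n (k : nat) (a : nat -> R) (w C N : R) :
  (forall n : nat, N <= n%:R -> `|a n - w| <= C / Num.sqrt n%:R) ->
  exists C' : R, 0 < C' /\
    forall n : nat, (k < n)%N -> a n <= w + C' / Num.sqrt n%:R.
Proof.
move=> H; pose M := (Num.truncn N).+1.
pose S : R := \sum_(i < M) `|a i - w| * Num.sqrt i%:R.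
have S0 : 0 <= S by apply: sumr_ge0 => i _; rewrite mulr_ge0// sqrtr_ge0.
have aC : C <= `|C| := ler_norm C.
have aC0 : 0 <= `|C| by [].
exists (`|C| + S + 1); split; first lra.
move=> n kn; have n0 : (0 < n)%N by rewrite (leq_ltn_trans _ kn).
have sn : 0 < Num.sqrt n%:R :> R by rewrite sqrtr_gt0 ltr0n.
suff : `|a n - w| <= (`|C| + S + 1) / Num.sqrt n%:R.
  by have := ler_norm (a n - w); lra.
rewrite ler_pdivlMr//; have [Mn|nM] := leqP M n.
  have Nn : N <= n%:R.
    by apply: (le_trans (ltW (truncnS_gt N))); rewrite ler_nat.
  by have := H n Nn; rewrite ler_pdivlMr//; lra.
have : `|a n - w| * Num.sqrt n%:R <= S.
  rewrite /S (bigD1 (Ordinal nM))//= lerDl.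
  by apply: sumr_ge0 => i _; rewrite mulr_ge0// sqrtr_ge0.
lra.
Qed.

End Rates.

(** The maximum over the percentiles is bounded by the sum of the individual bounds, whose mean is
    additive. Recording [0 <= G s] keeps the earlier bounds valid when a term is added. *)
Lemma quantiles_deviation {R : realType} (mu : probability R R) (v : seq R) :
  (forall p, p \in v -> exists C N : R, forall n : nat, N <= n%:R ->
    exists (G : seq R -> R) (a : R), [/\ has_iid_mean mu n G a,
    a <= C / Num.sqrt n%:R & forall s, size s = n ->
      `|ostat s (Num.truncn (n.-1%:R * p)) - cdf_inv mu p| <= G s]) ->
  exists C N : R, forall n : nat, N <= n%:R ->
    exists (G : seq R -> R) (a : R), [/\ has_iid_mean mu n G a,
    a <= C / Num.sqrt n%:R & forall s, size s = n -> 0 <= G s /\ forall p, p \in v ->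
      `|ostat s (Num.truncn (n.-1%:R * p)) - cdf_inv mu p| <= G s].
Proof.
elim: v => [_|p v IH H].
  exists 0, 0 => n _; exists (fun=> 0), 0.
  by split; [exact: has_iid_mean_cst|rewrite mul0r|].
have [C1 [N1 H1]] := H p (mem_head p v).
have [|C2 [N2 H2]] := IH; first by move=> r rv; apply: H; rewrite inE rv orbT.
exists (C1 + C2), (Num.max N1 N2) => n; rewrite ge_max => /andP[n1 n2].
have [G1 [a1 [m1 l1 b1]]] := H1 n n1; have [G2 [a2 [m2 l2 b2]]] := H2 n n2.
exists (fun s => G1 s + G2 s), (a1 + a2); split.
- exact: has_iid_meanD.
- by rewrite mulrDl lerD.
move=> s sn; have [G20 b2s] := b2 s sn; have b1s := b1 s sn.
have G10 : 0 <= G1 s by exact: le_trans b1s.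
split; first exact: addr_ge0.
move=> r; rewrite inE => /orP[/eqP->|/b2s rv].
  by apply: (le_trans b1s); rewrite lerDl.
by apply: (le_trans rv); rewrite lerDr.
Qed.

Theorem theorem4 (R : realType) (mu : probability R R) (I : interval R)
  (k : nat) (v : seq R) :
  standing_assumptions mu I ->
  (\int[mu]_x (`|x|)%:E < +oo)%E ->
  (compact [set x | x \in I] \/
   exists delta : R, 0 < delta /\
     (\int[mu]_x ((`|x|) `^ (2 + delta))%:E < +oo)%E) ->
  (0 < k)%N -> size v = k -> sorted <=%R v ->
  (forall t, t \in v -> 0 < t < 1) ->
  let Wratio := fine (W1 mu (nuQ mu v)) / fine (W1_k mu k) in
  (exists C N : R, forall n : nat, N <= n%:R ->
     `| B_ar_PM mu k n v - Wratio | <= C / Num.sqrt n%:R) /\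
  (exists C : R, 0 < C /\ forall n : nat, (k < n)%N ->
     B_ar_PM mu k n v <= Wratio + C / Num.sqrt n%:R).
Proof.
move=> [rho [[mrho _] muE muI rhoI drho]] L1 mom k0 vk vs v01 Wratio.
suff main : exists C N : R, forall n : nat, N <= n%:R ->
     `| B_ar_PM mu k n v - Wratio | <= C / Num.sqrt n%:R.
  by split=> //; have [C [N H]] := main; exact: rate_all_n H.
have v0 : (0 < size v)%N by rewrite vk.
have mom1 : mu.-integrable setT (EFin \o (fun x : R => `|x|)).
  apply/integrableP; split; first by apply/measurable_EFinP; exact: normr_measurable.
  by under eq_integral do rewrite /= normr_id.
have m1E := has_mean_Rintegral mom1; set m1 := Rintegral _ _ _ in m1E.
have [delta [K [m2 [d0 KE m2E]]]] := moments muI mom.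
have xE : has_mean mu id (\int[mu]_x x).
  by apply: has_mean_Rintegral; apply: (lipschitz1_integrable mom1 ler01) => x y; rewrite mul1r.
have sqE q : exists m, has_mean mu (fun x => (x - q) ^+ 2) m.
  eexists; have := has_meanD m2E (has_meanD (has_meanZ (- 2 * q) xE) (has_mean_cst mu (q ^+ 2))).
  by congr has_mean; apply/funext => x; ring.
have growth p (pv : p \in v) := cdf_inv_growth mrho muE muI rhoI drho m1E (v01 p pv).
have [C1 [N1 dev]] : exists C N : R, forall n : nat, N <= n%:R ->
    exists (G : seq R -> R) (a : R), [/\ has_iid_mean mu n G a,
    a <= C / Num.sqrt n%:R & forall s, size s = n -> 0 <= G s /\ forall p, p \in v ->
      `|ostat s (Num.truncn (n.-1%:R * p)) - cdf_inv mu p| <= G s].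
  apply: quantiles_deviation => p pv; have [c [e [c0 e0 _ gr gl]]] := growth p pv.
  have [m mE] := sqE (cdf_inv mu p).
  exact: (quantile_deviation (v01 p pv) c0 e0 gr gl mE).
have [C2 udev] := uniform_lipschitz_deviation d0 KE m2E.
pose qs := map (cdf_inv mu) v.
have qs0 : (0 < size qs)%N by rewrite size_map.
have qs_sorted : sorted <=%R qs.
  rewrite sorted_map; apply: (sub_in_sorted _ _ vs); last exact: allss.
  by move=> x y xv yv; apply: (cdf_inv_mono m1E); exact: v01.
have qsE := mindist_has_mean mom1 qs0; set A := Rintegral _ _ _ in qsE.
have A0 : 0 <= A by apply: Rintegral_ge0 => x _; exact: mindist_ge0.
have WA : W1 mu (nuQ mu v) = A%:E by rewrite nuQ_voronoi; exact: W1_voronoi.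
have [B [WB Ble leB]] := W1_k_inf mom1 k0.
have B0 : 0 < B.
  have pv := mem_nth 0 v0; have [c [e [c0 e0 inc _ _]]] := growth _ pv.
  have [b b0 Hb] := mindist_mean_lower c0 e0 k0 inc.
  apply: (lt_le_trans b0); apply: leB => ys ysk; apply: (Hb ys) => //.
  by apply: mindist_has_mean => //; rewrite ysk.
pose An n := fine (iid_expect mu n (fun xs => SC xs (PM v xs))).
pose Bn n := fine (iid_expect mu n (SC_opt k)).
have AnE n : (0 < n)%N -> has_iid_mean mu n (fun s => scost s (PM v s)) (An n).
  move=> n0; have [a aE] := lipschitz_has_iid_mean mom1 (ler0n R 2)
    (scost_PM_lipschitz v0 n0 v01).
  suff -> : An n = a by [].
  rewrite /An (@eq_iid_expect _ mu n _ (EFin \o (fun s => scost s (PM v s)))).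
    by rewrite (has_iid_mean_expect aE).
  by move=> s _; rewrite SCE// size_map.
have BnE n : (0 < n)%N -> has_iid_mean mu n (scost_opt k) (Bn n).
  move=> n0; have [a aE] := lipschitz_has_iid_mean mom1 ler01
    (scost_opt_lipschitz k0 n0).
  suff -> : Bn n = a by [].
  rewrite /Bn (@eq_iid_expect _ mu n _ (EFin \o (scost_opt k))).
    by rewrite (has_iid_mean_expect aE).
  by move=> s _; rewrite SC_optE.
have scostE n ys : (0 < n)%N -> (0 < size ys)%N ->
    has_iid_mean mu n (fun s => scost s ys) (\int[mu]_x mindist ys x).
  move=> n0 ys0; have := has_iid_meanZ n%:R^-1
    (has_iid_mean_linear n 0 (mindist_has_mean mom1 ys0)).
  rewrite add0r mulKf ?pnatr_eq0 -?lt0n//; apply: eq_has_iid_mean => s sn.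
  by rewrite /scost add0r sn.
rewrite /Wratio WA WB /=; apply: (@ratio_rate _ A B C1 C2 N1 An Bn) => // n n0.
  move=> N1n; have [G [a [GE aC Gb]]] := dev n N1n; apply: le_trans aC.
  have close s : size s = n -> `|scost s (PM v s) - scost s qs| <= G s.
    move=> sn; have [G0 Gp] := Gb s sn.
    apply: scost_close; rewrite ?size_map ?sn// => j jv.
    by rewrite nth_PM// (nth_map 0)// sn; apply: Gp; rewrite mem_nth.
  have qE := scostE n qs n0 qs0.
  apply/ler_normlP; rewrite opprB !lerBlDr; split.
    apply: has_iid_mean_le qE (has_iid_meanD GE (AnE n n0)) _ => s sn.
    by have /ler_normlP[] := close s sn; lra.
  apply: has_iid_mean_le (AnE n n0) (has_iid_meanD GE qE) _ => s sn.
  by have /ler_normlP[] := close s sn; lra.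
have BnB : Bn n <= B.
  apply: leB => ys ysk; have ys0 : (0 < size ys)%N by rewrite ysk.
  apply: has_iid_mean_le (BnE n n0) (scostE n ys n0 ys0) _ => s sn.
  exact: scost_opt_le.
have [D [a [DE aC Db]]] := udev n n0.
(* As [D] does not depend on [ys], the infimum over configurations is taken sample by sample, before
   integrating. *)
have BDn : B <= a + Bn n.
  apply: has_iid_mean_le (has_iid_mean_cst mu n B) (has_iid_meanD DE (BnE n n0)) _ => s sn.
  rewrite addrC -lerBlDr; apply: le_scost_opt => // ys ysk.
  have ys0 : (0 < size ys)%N by rewrite ysk.
  have := Db _ _ s (mindist_lipschitz ys0) (mindist_has_mean mom1 ys0) sn.
  by have := Ble ys ysk; rewrite /scost sn; lra.
by rewrite distrC ger0_norm ?subr_ge0//; lra.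
Qed.
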